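(* Let $\alpha,\beta>-\frac12$. For $N\ge1$ let $\widetilde G_N\in\mathbb{R}^{N\times N}$ be the Gram matrix $$[\widetilde G_N]_{\ell,k}=\int_{-1}^1P^{(\alpha,\beta)}_{\ell-1}(x)\,P^{(\alpha,\beta)}_{k-1}(x)\,(\omega_{\alpha,\beta}(x))^2\,dx,\quad \ell,k=1,\dots,N.$$ Then there exists a constant $C(\alpha,\beta)>0$, depending only on $\alpha$ and $\beta$, such that $$\lambda_{\max}(\widetilde G_N)\le C(\alpha,\beta)\,(1+\log N),\quad N\ge1,$$ where $\lambda_{\max}$ denotes the maximum eigenvalue.
   Context: For $\alpha,\beta>-1$, $\omega_{\alpha,\beta}(t)=(1-t)^\alpha(1+t)^\beta$ on $[-1,1]$, and $P_j^{(\alpha,\beta)}$ is the Jacobi polynomial of degree $j$, orthogonal on $[-1,1]$ with respect to $\omega_{\alpha,\beta}$, with the standard normalization $P_j^{(\alpha,\beta)}(1)=\frac{\Gamma(j+\alpha+1)}{\Gamma(j+1)\Gamma(\alpha+1)}$. *)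

(* Defs.v *)
From HB Require Import structures.
From mathcomp Require Import all_boot all_order all_algebra.
From mathcomp Require Import all_classical all_reals all_analysis.
From mathcomp Require Import spectral sesquilinear complex polyrcf.
Import Order.TTheory GRing.Theory Num.Theory.
Import numFieldNormedType.Exports.

Set Implicit Arguments.
Unset Strict Implicit.
Unset Printing Implicit Defensive.

Local Open Scope classical_set_scope.
Local Open Scope ring_scope.

Section Defs.
Context {R : realType}.
Implicit Types (a b t x : R) (P : nat -> {poly R}).

(* Euler's integral; it is only meaningful for 0 < x. *)
Definition Gamma x : R :=
  Rintegral (@lebesgue_measure R) `]0, +oo[ (fun t => t `^ (x - 1) * expR (- t)).

(* At t = 1 and t = -1, powR gives 0 `^ c = (c == 0)%:R also for c < 0; these
   two points are negligible for the integrals below. *)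
Definition jacobi_weight a b t : R := (1 - t) `^ a * (1 + t) `^ b.

Definition is_jacobi a b P : Prop :=
  [/\ forall j, size (P j) = j.+1,
      forall i j, i <> j ->
        Rintegral (@lebesgue_measure R) `[-1, 1]
          (fun x => (P i).[x] * (P j).[x] * jacobi_weight a b x) = 0 &
      forall j, (P j).[1] =
        Gamma (j%:R + a + 1) / (Gamma (j%:R + 1) * Gamma (a + 1))].

(* Rows and columns are indexed from 0, by the degree of the polynomial. *)
Definition gram a b P N : 'M[R]_N :=
  \matrix_(l < N, k < N)
    Rintegral (@lebesgue_measure R) `[-1, 1]
      (fun x => (P l).[x] * (P k).[x] * jacobi_weight a b x ^+ 2).

(* For a nonempty symmetric matrix this supremum is a maximum: lambda_maxP. *)
Definition lambda_max n (A : 'M[R]_n) : R := sup [set c | eigenvalue A c].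

End Defs.

Lemma symmetric_eigenvalue (R : realType) n (A : 'M[R]_n.+1) :
  A^T = A -> exists c, eigenvalue A c.
Proof.
move=> symA; pose f : {rmorphism R -> complex R} := real_complex R.
pose B := map_mx f A.
have hB : B \is hermsymmx.
  apply: realsym_hermsym.
    apply/is_hermitianmxP; rewrite expr0 scale1r map_mx_id //.
    by rewrite /B map_trmx symA.
  apply/mxOverP => i j; rewrite mxE; apply/complex_realP; by exists (A i j).
have hd := hermitian_spectral_diag_real hB.
have /orthomx_spectralP eqB := hermitian_normalmx hB.
set S := spectralmx B in eqB; set d := spectral_diag B in eqB.
have uS : S \in unitmx := spectral_unit B.
have /mxOverP/(_ 0 0)/complex_realP[c dc] := hd.
exists c; rewrite -(eigenvalue_map f) -/B; apply/eigenvalueP; exists (row 0 S).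
  rewrite -row_mul [in LHS]eqB !mulmxA mulmxV // mul1mx row_mul row_diag_mx.
  by rewrite -scalemxAl -rowE /d dc.
apply/eqP => S0; have := row_mul 0 S (invmx S).
rewrite S0 mul0mx mulmxV // => /rowP/(_ 0); rewrite !mxE eqxx => /eqP.
by rewrite oner_eq0.
Qed.

Lemma lambda_maxP (R : realType) n (A : 'M[R]_n.+1) : A^T = A ->
  eigenvalue A (lambda_max A) /\ forall c, eigenvalue A c -> c <= lambda_max A.
Proof.
move=> /symmetric_eigenvalue[c0 Ac0].
set p := char_poly A; have p0 : p != 0 by rewrite monic_neq0 ?char_poly_monic.
pose s := rootsR p.
have sE c : (c \in s) = eigenvalue A c.
  have /(_ c) := roots_on_rootsR p0; rewrite in_itv /= => <-.
  by rewrite eigenvalue_root_char.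
have: exists2 m, m \in s & forall c, c \in s -> c <= m.
  have: s != [::] by apply/eqP => s0; have := sE c0; rewrite Ac0 s0.
  elim: {sE} s => // x [_ _|y s /(_ isT)[m ms mge] _].
    by exists x => [|c]; rewrite inE // => /eqP ->.
  have [xm|/ltW mx] := leP x m.
    exists m => [|c]; first by rewrite inE ms orbT.
    by rewrite inE => /predU1P[->//|/mge].
  exists x => [|c]; first by rewrite mem_head.
  by rewrite inE => /predU1P[->//|/mge /le_trans]; apply.
move=> [m ms mge]; suff -> : lambda_max A = m.
  by split=> [|c]; rewrite -sE // => /mge.
apply/eqP; rewrite eq_le; apply/andP; split.
  by apply: ge_sup => [|c]; [exists c0|rewrite /= -sE => /mge].
apply: ub_le_sup; last by rewrite /= -sE.
by exists m => c /=; rewrite -sE => /mge.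
Qed.

Lemma gram_sym (R : realType) (a b : R) (P : nat -> {poly R}) N :
  (gram a b P N)^T = gram a b P N.
Proof.
apply/matrixP => l k; rewrite !mxE; congr Rintegral; apply/funext => x.
by rewrite [X in X * _]mulrC.
Qed.

(* Main.v *)
Require Import Defs.
From HB Require Import structures.
From mathcomp Require Import all_boot all_order all_algebra.
From mathcomp Require Import all_classical all_reals all_analysis.
From mathcomp Require Import measurable_realfun polyrcf ring lra.
Import Order.TTheory GRing.Theory Num.Theory.
Import numFieldNormedType.Exports.

Set Implicit Arguments.
Unset Strict Implicit.
Unset Printing Implicit Defensive.

Local Open Scope classical_set_scope.
Local Open Scope ring_scope.

(** Write w = (1-x)^a (1+x)^b and W = (1-x)^(a+1/2) (1+x)^(b+1/2).

    A matrix with entries at most K u_i u_j in absolute value has no eigenvalue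
    above K times the sum of the u_i^2 ([eigenvalue_le_weights]).  It is thus
    enough to bound the (i, j) entry of the Gram matrix by
    K / sqrt ((i+1)(j+1)): the sum of the u_i^2 is then the N-th harmonic number,
    which is at most 1 + ln N.

    The entries are controlled by a Bernstein-type inequality
    ([jacobi_weighted_bound]): W P_n^2 <= K / (n+1) on [-1, 1].  Indeed
    w^2 = W (1-x)^(a-1/2) (1+x)^(b-1/2), and the last two factors are integrable
    because a, b > -1/2.

    The inequality is proved from the differential equation
    s y'' + (q - x) y' + l y = 0, where s = 1 - x^2, q = b - a - (a+b+1) x and
    l = n (n+a+b+1), which the orthogonality relations imply ([jacobi_ode]).
    Sonin's energy F = l y^2 + s y'^2 has F' = - 2 q y'^2, so it increases when x
    moves from the zero of q towards either endpoint.  Three regions are treated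
    separately, M being a constant that depends on a and b only.

    - In the layer 1 - x <= M / l one has y(x)^2 <= y(1)^2, and
      y(1)^2 = O(n^(2a)) by the normalization and the functional equation of
      Gamma, while W = O(n^(-2a-1)).
    - Between the two layers F W is nearly conserved: after lower-order
      corrections its logarithmic derivative is O(1 / (l s^2)), whose integral
      is bounded uniformly in l ([energy_middle_le]).  So F W, and with it
      l W y^2, stays below a constant times its value at the right layer.
    - In the layer 1 + x <= M / l one has y(x)^2 <= y(-1)^2.  No value at -1 is
      prescribed, but y(-1) is at most twice y at distance (b+1/2) / l, since
      y' = O(l y(-1)) near -1 ([sqr_left_end_le]); and F (1+x)^(2b+1) is
      nondecreasing, which compares F there with F at the edge of the layer. *)

(** * Integrals over an increasing union of segments *)

Section Exhaustion.
Variable R : realType.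
Notation mu := (@lebesgue_measure R).
Variables (u v : nat -> R) (D : set R).
Hypothesis uv : forall n, u n < v n.
Hypothesis uD : nonincreasing_seq u.
Hypothesis vD : nondecreasing_seq v.
Hypothesis DE : D = \bigcup_n `[u n, v n]%classic.
Variables f F : R -> R.
Hypothesis fc : forall x, D x -> {for x, continuous f}.
Hypothesis dF : forall x, D x -> is_derive x 1 F (f x).

Let mItv n : measurable `[u n, v n]%classic. Proof. exact: measurable_itv. Qed.

Let itvD n : `[u n, v n]%classic `<=` D.
Proof. by rewrite DE => x xn; exists n. Qed.

Let nd : nondecreasing_seq (fun n => `[u n, v n]%classic).
Proof.
move=> m n mn; apply/subsetPset; apply: subset_itv; rewrite bnd_simp.
  exact: uD.
exact: vD.
Qed.

Lemma exhaust_measurable : measurable D.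
Proof. by rewrite DE; apply: bigcupT_measurable. Qed.

Let within_f n : {within `[u n, v n], continuous f}.
Proof.
apply: continuous_in_subspaceT => x /set_mem /itvD; exact: fc.
Qed.

Lemma exhaust_measurable_fun : measurable_fun D f.
Proof.
rewrite DE; apply/measurable_fun_bigcup => // n.
exact: subspace_continuous_measurable_fun.
Qed.

(** On each segment of the exhaustion f is continuous, so the ordinary
    fundamental theorem applies there, even if f blows up at the ends of D. *)
Lemma exhaust_FTC2 n :
  (\int[mu]_(x in `[u n, v n]) (f x)%:E = (F (v n) - F (u n))%:E)%E.
Proof.
have un : D (u n) by apply: (@itvD n); rewrite /= in_itv /= lexx ltW.
have vn : D (v n) by apply: (@itvD n); rewrite /= in_itv /= lexx ltW.
have Fc x : D x -> {for x, continuous F}.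
  by move=> /dF dx; apply/differentiable_continuous/derivable1_diffP.
have xD x : x \in `]u n, v n[%R -> D x.
  by rewrite in_itv => /andP[ux xv]; apply: (@itvD n); rewrite /= in_itv/= !ltW.
rewrite (@continuous_FTC2 _ f F) //.
- split.
  + by move=> x /xD/dF dx.
  + exact/cvg_at_right_filter/Fc.
  + exact/cvg_at_left_filter/Fc.
- by move=> x /xD/dF dx; rewrite derive1E derive_val.
Qed.

Lemma ge0_exhaust_integrable (M : R) :
  (forall x, D x -> 0 <= f x) -> (forall x, D x -> `|F x| <= M) ->
  mu.-integrable D (EFin \o f).
Proof.
move=> f0 FM; apply/integrableP; split.
  by apply/measurable_EFinP; exact: exhaust_measurable_fun.
have -> : (\int[mu]_(x in D) `|(EFin \o f) x| = \int[mu]_(x in D) (f x)%:E)%E.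
  by apply: eq_integral => x /set_mem Dx /=; rewrite ger0_norm // f0.
have cv : (\int[mu]_(x in `[u n, v n]) (f x)%:E)%E @[n --> \oo]
    --> (\int[mu]_(x in D) (f x)%:E)%E.
  rewrite DE; apply: ge0_nondecreasing_set_cvg_integral => //.
  - move=> n; apply/measurable_EFinP.
    exact: subspace_continuous_measurable_fun.
  - by move=> n x xn; rewrite lee_fin; apply/f0/(@itvD n).
apply: (@le_lt_trans _ _ (M + M)%:E); last exact: ltry.
apply: (cvge_le _ cv); apply: nearW => n; rewrite exhaust_FTC2 lee_fin.
have un : D (u n) by apply: (@itvD n); rewrite /= in_itv /= lexx ltW.
have vn : D (v n) by apply: (@itvD n); rewrite /= in_itv /= lexx ltW.
have := FM _ un; have := FM _ vn; rewrite !ler_norml; lra.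
Qed.

Lemma exhaust_Rintegral (l : R) : mu.-integrable D (EFin \o f) ->
  F (v n) - F (u n) @[n --> \oo] --> l ->
  Rintegral mu D f = l.
Proof.
move=> fi Fl.
have mD := exhaust_measurable.
pose g n := (EFin \o f) \_ `[u n, v n]%classic.
have [] := @dominated_convergence _ _ _ mu D mD g (EFin \o f)
  (abse \o (EFin \o f)).
- move=> n; apply/(measurable_restrict (EFin \o f) (mItv n) mD).
  by apply: measurable_funS (measurable_int _ fi) => // x [].
- exact: measurable_int fi.
- apply: aeW => /= x Dx; apply: cvg_near_cst.
  have [n _ xn] : (\bigcup_n `[u n, v n]%classic) x by rewrite -DE.
  near=> m; rewrite /g patchE mem_set //.
  have /nd/subsetPset : (n <= m)%N by near: m; exact: nbhs_infty_ge.
  exact.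
- exact: integrable_abse.
- apply: aeW => x n Dx; rewrite /g patchE; case: ifP => // _ /=.
  by rewrite normr0 lee_fin.
move=> _ _; set h := (X in X @ \oo --> _) => cv.
have hE : h = EFin \o (fun n => F (v n) - F (u n)).
  apply/funext => n; rewrite /h /= -exhaust_FTC2.
  have <- : D `&` [set` `[u n, v n]] = [set` `[u n, v n]].
    by rewrite setIC; apply/setIidPl/itvD.
  by rewrite integral_mkcondr; apply: eq_integral.
rewrite /Rintegral -[RHS]/(fine l%:E); congr fine.
apply/esym/(@cvg_unique _ (@ereal_hausdorff R) (h @ \oo)) => //.
by rewrite hE; apply: cvg_EFin => //; exact: nearW.
Unshelve. all: by end_near. Qed.

End Exhaustion.

(** * The weights and their integrals *)

Lemma harmonic_small (R : realType) (e : R) : 0 < e ->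
  exists n, forall m, (n <= m)%N -> harmonic m < e.
Proof.
move=> e0; have [n _ Hn] := near_infty_natSinv_lt (PosNum e0).
by exists n => m nm; apply: Hn.
Qed.

Lemma harmonic_nincr (R : realType) : nonincreasing_seq (@harmonic R).
Proof. by move=> m n mn; rewrite lef_pV2 ?posrE ?ltr0n // ler_nat. Qed.

Lemma cvg_harmonic_powR (R : realType) (c : R) : 0 < c ->
  (harmonic n `^ c) @[n --> \oo] --> (0 : R).
Proof.
move=> c0; apply: (@cvg_comp _ _ _ (@harmonic R) (fun t => t `^ c) _ (0^'+)).
  move=> A [e /= e0 eA]; have [n nh] := harmonic_small e0.
  exists n => // m /= nm; apply: eA; last exact: harmonic_gt0.
  by rewrite /= sub0r normrN ger0_norm ?harmonic_ge0 // nh.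
exact: powR_cvg0.
Qed.

Section Weight.
Variable R : realType.
Notation mu := (@lebesgue_measure R).
Implicit Types a b c d x t : R.

Let u (n : nat) : R := -1 + harmonic n.+1.
Let v (n : nat) : R := 1 - harmonic n.+1.
Let D : set R := `]-1, 1[%classic.

Let h_gt0 n : 0 < harmonic n.+1 :> R. Proof. exact: harmonic_gt0. Qed.

Let h_lt1 n : harmonic n.+1 < 1 :> R.
Proof. by rewrite /= invf_lt1 ?ltr0n // ltr1n. Qed.

Let uv n : u n < v n.
Proof. by have := h_lt1 n; rewrite /u /v; lra. Qed.

Let uD : nonincreasing_seq u.
Proof. by move=> m n mn; rewrite lerD2l harmonic_nincr. Qed.

Let vD : nondecreasing_seq v.
Proof. by move=> m n mn; rewrite lerD2l lerN2 harmonic_nincr. Qed.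

Let DE : D = \bigcup_n `[u n, v n]%classic.
Proof.
apply/seteqP; split=> x.
  rewrite /D /= in_itv /= => /andP[x1 x2].
  have [|n nh] := @harmonic_small R (Num.min (1 + x) (1 - x)).
    by rewrite lt_min; apply/andP; split; lra.
  exists n => //=; rewrite in_itv /=.
  have := nh n.+1 (leqnSn n); rewrite lt_min => /andP[h1 h2].
  by apply/andP; split; rewrite /u /v; lra.
move=> [n _]; rewrite /D /= !in_itv /= => /andP[].
by rewrite /u /v; have := h_gt0 n => *; apply/andP; split; lra.
Qed.

Lemma is_derive_1Bx_powR c x : x < 1 ->
  is_derive x 1 (fun t => (1 - t) `^ c) (- (c * (1 - x) `^ (c - 1))).
Proof.
move=> x1; have x0 : 0 < 1 - x by lra.
have h := @is_derive1_powR R c _ x0.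
have h2 : is_derive x 1 (fun t : R => 1 - t) (-1).
  by apply: is_derive_eq; ring.
have := @is_derive1_comp _ (fun t => t `^ c) (fun t => 1 - t) x _ _ h h2.
by rewrite mulrN1.
Qed.

Lemma is_derive_1Dx_powR c x : -1 < x ->
  is_derive x 1 (fun t => (1 + t) `^ c) (c * (1 + x) `^ (c - 1)).
Proof.
move=> x1; have x0 : 0 < 1 + x by lra.
have h := @is_derive1_powR R c _ x0.
have h2 : is_derive x 1 (fun t : R => 1 + t) 1.
  by apply: is_derive_eq; ring.
have := @is_derive1_comp _ (fun t => t `^ c) (fun t => 1 + t) x _ _ h h2.
by rewrite mulr1.
Qed.

Lemma powR_subr1 c t : 0 < t -> t `^ (c - 1) = t `^ c / t.
Proof.
by move=> t0; rewrite powRB ?(gt_eqF t0) ?implybT // powRr1 // ltW.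
Qed.

Lemma powR_div_exp m l c : 0 <= m -> 0 < l ->
  (m / l) `^ c = m `^ c * l `^ (- c).
Proof.
move=> m0 l0; rewrite powRM ?invr_ge0 ?(ltW l0) //.
by rewrite -powR_inv1 ?(ltW l0) // -powRrM mulN1r.
Qed.

Lemma is_derive_jacobi_weight c d x : -1 < x < 1 ->
  is_derive x 1 (jacobi_weight c d)
    (jacobi_weight c d x * (d / (1 + x) - c / (1 - x))).
Proof.
move=> /andP[x1 x2].
apply: (@trigger_derive _ _ _ _ _
  (is_deriveM (is_derive_1Bx_powR c x2) (is_derive_1Dx_powR d x1))).
rewrite !powR_subr1; [|lra..].
by rewrite /jacobi_weight /GRing.scale /=; ring.
Qed.

Lemma is_derive_continuous (f : R -> R) df x :
  is_derive x 1 f df -> {for x, continuous f}.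
Proof. by move=> dx; apply/differentiable_continuous/derivable1_diffP. Qed.

Lemma itvN11_bounds x : D x -> -1 < x < 1.
Proof. by rewrite /D /= in_itv. Qed.

(** A bound that does not depend on the sign of c: the factor of a Jacobi weight
    that stays away from its singularity is bounded. *)
Lemma powR_le_pow2 c t : 1 <= t <= 2 -> t `^ c <= 1 + 2 `^ c.
Proof.
move=> /andP[t1 t2]; have [c0|c0] := leP 0 c.
  apply: (@le_trans _ _ (2 `^ c)); last by rewrite lerDr.
  by apply: ge0_ler_powR; rewrite ?nnegrE; lra.
apply: (@le_trans _ _ 1); last by rewrite lerDl powR_ge0.
by rewrite -(@powRr0 R t) ler_powR // ltW.
Qed.

Lemma integrable_powR_1Bx c : -1 < c ->
  mu.-integrable D (EFin \o (fun x => (1 - x) `^ c)).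
Proof.
move=> c1; have c10 : 0 < c + 1 by lra.
apply: (@ge0_exhaust_integrable _ u v D uv uD vD DE _
  (fun x => (1 - x) `^ (c + 1) * (- (c + 1)^-1)) _ _ (2 `^ (c + 1) / (c + 1))).
- move=> x /itvN11_bounds /andP[_ x1].
  exact: is_derive_continuous (is_derive_1Bx_powR c x1).
- move=> x /itvN11_bounds /andP[_ x1].
  apply: (@trigger_derive _ _ _ _ _ (is_deriveM
    (is_derive_1Bx_powR (c + 1) x1) (is_derive_cst (- (c + 1)^-1) x 1))).
  rewrite addrK /GRing.scale /=; field; lra.
- by move=> x _; exact: powR_ge0.
- move=> x /itvN11_bounds /andP[x1 x2].
  rewrite normrM normrN !ger0_norm ?powR_ge0 ?invr_ge0 ?(ltW c10) //.
  rewrite ler_wpM2r ?invr_ge0 ?(ltW c10) //.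
  by apply: ge0_ler_powR; rewrite ?nnegrE; lra.
Qed.

Lemma integrable_powR_1Dx c : -1 < c ->
  mu.-integrable D (EFin \o (fun x => (1 + x) `^ c)).
Proof.
move=> c1; have c10 : 0 < c + 1 by lra.
apply: (@ge0_exhaust_integrable _ u v D uv uD vD DE _
  (fun x => (1 + x) `^ (c + 1) * (c + 1)^-1) _ _ (2 `^ (c + 1) / (c + 1))).
- move=> x /itvN11_bounds /andP[x1 _].
  exact: is_derive_continuous (is_derive_1Dx_powR c x1).
- move=> x /itvN11_bounds /andP[x1 _].
  apply: (@trigger_derive _ _ _ _ _ (is_deriveM
    (is_derive_1Dx_powR (c + 1) x1) (is_derive_cst ((c + 1)^-1) x 1))).
  rewrite addrK /GRing.scale /=; field; lra.
- by move=> x _; exact: powR_ge0.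
- move=> x /itvN11_bounds /andP[x1 x2].
  rewrite normrM !ger0_norm ?powR_ge0 ?invr_ge0 ?(ltW c10) //.
  rewrite ler_wpM2r ?invr_ge0 ?(ltW c10) //.
  by apply: ge0_ler_powR; rewrite ?nnegrE; lra.
Qed.

Lemma jacobi_weight_ge0 c d x : 0 <= jacobi_weight c d x.
Proof. by rewrite mulr_ge0 ?powR_ge0. Qed.

Lemma jacobi_weight_gt0 c d x : -1 < x < 1 -> 0 < jacobi_weight c d x.
Proof. by move=> /andP[? ?]; rewrite mulr_gt0 ?powR_gt0 //; lra. Qed.

Lemma jacobi_weight_continuous c d x : D x ->
  {for x, continuous (jacobi_weight c d)}.
Proof.
move=> /itvN11_bounds/(is_derive_jacobi_weight c d).
exact: is_derive_continuous.
Qed.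

Lemma jacobi_weight_measurable c d : measurable_fun D (jacobi_weight c d).
Proof.
by apply: (exhaust_measurable_fun DE) => x; exact: jacobi_weight_continuous.
Qed.

(** Each half of the interval sees only one singularity, so the weight is at most
    a multiple of (1-x)^c + (1+x)^d. *)
Lemma integrable_jacobi_weight c d : -1 < c -> -1 < d ->
  mu.-integrable D (EFin \o jacobi_weight c d).
Proof.
move=> c1 d1; have mD : measurable D by exact: measurable_itv.
pose K : R := 1 + 2 `^ c + 2 `^ d.
have K1 : 0 < K.
  by have := powR_ge0 (2:R) c; have := powR_ge0 (2:R) d; rewrite /K; lra.
pose g x := K * ((1 - x) `^ c + (1 + x) `^ d).
apply: (@le_integrable _ _ _ mu D mD _ (EFin \o g)).
- by apply/measurable_EFinP; exact: jacobi_weight_measurable.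
- move=> x /itvN11_bounds /andP[x1 x2] /=; rewrite lee_fin.
  rewrite !ger0_norm ?jacobi_weight_ge0 //; last first.
    by rewrite /g mulr_ge0 ?addr_ge0 ?powR_ge0 // ltW.
  have A0 := powR_ge0 (1 - x) c; have B0 := powR_ge0 (1 + x) d.
  have Q0 := powR_ge0 (2:R) c; have P0 := powR_ge0 (2:R) d.
  rewrite /g /jacobi_weight mulrDr.
  have [x0|x0] := leP 0 x.
    have Bd : (1 + x) `^ d <= K.
      apply: (@le_trans _ _ (1 + 2 `^ d)); last by rewrite /K; lra.
      by apply: powR_le_pow2; apply/andP; split; lra.
    by rewrite [_ * (1 + x) `^ d]mulrC ler_wpDr ?ler_wpM2r // mulr_ge0 // ltW.
  have Ac : (1 - x) `^ c <= K.
    apply: (@le_trans _ _ (1 + 2 `^ c)); last by rewrite /K; lra.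
    by apply: powR_le_pow2; apply/andP; split; lra.
  by rewrite ler_wpDl ?ler_wpM2r // mulr_ge0 // ltW.
- pose g1 x := (1 - x) `^ c; pose g2 x := (1 + x) `^ d.
  have -> : EFin \o g = (fun x => K%:E * ((EFin \o g1) \+ (EFin \o g2)) x)%E.
    by apply/funext => x.
  apply: integrableZl => //; apply: integrableD => //.
  + exact: integrable_powR_1Bx.
  + exact: integrable_powR_1Dx.
Qed.

Lemma jacobi_weight_split a b x : -1 < x < 1 ->
  jacobi_weight (a + 2^-1) (b + 2^-1) x =
  (1 - x ^+ 2) * jacobi_weight (a - 2^-1) (b - 2^-1) x.
Proof.
move=> /andP[x1 x2].
have e1 : a - 2^-1 = (a + 2^-1) - 1 by field.
have e2 : b - 2^-1 = (b + 2^-1) - 1 by field.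
rewrite /jacobi_weight e1 e2 !powR_subr1; [|lra..].
by field; apply/andP; split; lra.
Qed.

Lemma jacobi_weight_le a b x c d : 0 <= a -> 0 <= b -> -1 <= x <= 1 ->
  1 - x <= c -> 1 + x <= d -> jacobi_weight a b x <= c `^ a * d `^ b.
Proof.
move=> a0 b0 /andP[x1 x2] xc xd.
apply: ler_pM; rewrite ?powR_ge0 //.
  by apply: ge0_ler_powR; rewrite ?nnegrE //; lra.
by apply: ge0_ler_powR; rewrite ?nnegrE //; lra.
Qed.

Lemma horner_bounded (p : {poly R}) :
  exists2 M : R, 0 <= M & forall x, D x -> `|p.[x]| <= M.
Proof.
exists (\sum_(i < size p) `|p`_i|) => [|x /itvN11_bounds /andP[x1 x2]].
  by apply: sumr_ge0.
rewrite horner_coef; apply: (le_trans (ler_norm_sum _ _ _)).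
apply: ler_sum => i _; rewrite normrM ler_piMr // normrX exprn_ile1 //.
by rewrite ler_norml; apply/andP; split; lra.
Qed.

Lemma integrable_poly_weight c d (p : {poly R}) : -1 < c -> -1 < d ->
  mu.-integrable D (EFin \o (fun x => p.[x] * jacobi_weight c d x)).
Proof.
move=> c1 d1; have mD : measurable D by exact: measurable_itv.
have -> : EFin \o (fun x => p.[x] * jacobi_weight c d x) =
    ((EFin \o horner p) \* (EFin \o jacobi_weight c d))%E.
  by apply/funext => x /=; rewrite EFinM.
apply: integrableMr => //; last exact: integrable_jacobi_weight.
  exact: measurable_poly.
have [M M0 HM] := horner_bounded p.
exists M; split; first exact: num_real.
by move=> N MN x Dx; apply: (le_trans (HM x Dx)); exact: ltW.
Qed.

Definition poly_horner := (@hornerD, @hornerN, @hornerM, @hornerXn, @hornerX,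
  @hornerC, @hornerZ).

(** The weighted divergence w^-1 ((1 - x^2) w p)', for the weight w with exponents
    a and b; the Jacobi operator is p |-> wdiv p'. *)
Definition wdiv a b (p : {poly R}) : {poly R} :=
  (1 - 'X^2) * p^`() + ((b - a)%:P - (a + b + 2)%:P * 'X) * p.

Definition jacobi_eq a b l (y : {poly R}) : Prop :=
  wdiv a b y^`() + l *: y = 0.

(** The integrand is the derivative of p (1-x)^(a+1) (1+x)^(b+1), which vanishes
    at both endpoints. *)
Lemma Rintegral_wdiv a b (p : {poly R}) : -1 < a -> -1 < b ->
  Rintegral mu D (fun x => (wdiv a b p).[x] * jacobi_weight a b x) = 0.
Proof.
move=> a1 b1.
pose F x := p.[x] * jacobi_weight (a + 1) (b + 1) x.
apply: (@exhaust_Rintegral _ u v D uv uD vD DE _ F).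
- move=> x Dx; have /itvN11_bounds xD := Dx.
  exact: is_derive_continuous (is_deriveM (is_derive_poly (wdiv a b p) x)
    (is_derive_jacobi_weight a b xD)).
- move=> x /itvN11_bounds xD; have /andP[x1 x2] := xD.
  apply: (@trigger_derive _ _ _ _ _ (is_deriveM (is_derive_poly p x)
    (is_derive_jacobi_weight (a + 1) (b + 1) xD))).
  rewrite /GRing.scale /=.
  have -> : jacobi_weight (a + 1) (b + 1) x =
      (1 - x) * (1 + x) * jacobi_weight a b x.
    rewrite /jacobi_weight -(addrK 1 a) -(addrK 1 b).
    rewrite !powR_subr1 ?addrK; [|lra..].
    by field; apply/andP; split; lra.
  rewrite /wdiv !poly_horner; field; apply/andP; split; lra.
- exact: integrable_poly_weight.
have [M M0 HM] := horner_bounded p.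
pose K := M * (1 + 2 `^ (a + 1) + 2 `^ (b + 1)).
have K0 : 0 <= K by rewrite mulr_ge0 // !addr_ge0 // powR_ge0.
have h0 c : -1 < c -> K * harmonic n.+1 `^ (c + 1) @[n --> \oo] --> (0 : R).
  move=> c1; rewrite -(mulr0 K); apply: cvgMr.
  have /cvg_harmonic_powR : 0 < c + 1 by lra.
  by rewrite -cvg_shiftS.
have hb n : 1 <= (2 - harmonic n.+1 : R) <= 2.
  by have := h_gt0 n; have := h_lt1 n => *; apply/andP; split; lra.
have Dv n : D (v n).
  by rewrite DE; exists n; rewrite //= in_itv /= lexx (ltW (uv n)).
have Du n : D (u n).
  by rewrite DE; exists n; rewrite //= in_itv /= lexx (ltW (uv n)).
have bd h k c d x : D x -> 0 <= h -> 1 <= k <= 2 -> d = a \/ d = b ->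
    `|p.[x] * (h `^ c * k `^ (d + 1))| <= K * h `^ c.
  move=> Dx hge0 k12 dab; rewrite /K mulrAC mulrA normrM.
  have kK : k `^ (d + 1) <= 1 + 2 `^ (a + 1) + 2 `^ (b + 1).
    apply: (le_trans (powR_le_pow2 _ k12)).
    have A0 := powR_ge0 (2:R) (a + 1); have B0 := powR_ge0 (2:R) (b + 1).
    by case: dab => ->; lra.
  rewrite (ger0_norm (powR_ge0 _ _)) normrM (ger0_norm (powR_ge0 _ _)).
  by apply: ler_pM; rewrite ?mulr_ge0 ?powR_ge0 ?ler_wpM2r ?powR_ge0 ?HM.
rewrite -[X in _ --> X]subr0; apply: cvgB.
- apply/norm_cvg0P; apply: (squeeze_cvgr _ (cvg_cst 0) (h0 a a1)).
  apply: nearW => n; rewrite normr_ge0 /F /jacobi_weight.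
  have -> : 1 - v n = harmonic n.+1 by rewrite /v; ring.
  have -> : 1 + v n = 2 - harmonic n.+1 by rewrite /v; ring.
  by rewrite bd //; [exact: ltW | right].
- apply/norm_cvg0P; apply: (squeeze_cvgr _ (cvg_cst 0) (h0 b b1)).
  apply: nearW => n; rewrite normr_ge0 /F /jacobi_weight [_ `^ _ * _]mulrC.
  have -> : 1 + u n = harmonic n.+1 by rewrite /u; ring.
  have -> : 1 - u n = 2 - harmonic n.+1 by rewrite /u; ring.
  by rewrite bd //; [exact: ltW | left].
Qed.

End Weight.

(** * The functional equation of the Gamma function *)

Section GammaFunction.
Variable R : realType.
Notation mu := (@lebesgue_measure R).
Implicit Types c s t x : R.

(** From ln (s / c) < s / c, multiplied by c. *)
Lemma powR_le_expR c s : 0 < c -> 0 < s -> s `^ c <= c `^ c * expR s.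
Proof.
move=> c0 s0; rewrite /powR (gt_eqF s0) (gt_eqF c0) -expRD ler_expR.
have -> : ln s = ln c + ln (s / c).
  by rewrite -lnM ?posrE ?divr_gt0 // mulrC divfK // gt_eqF.
rewrite mulrDr lerD2l -ler_pdivlMl // [c^-1 * s]mulrC.
by apply/ltW/ln_sublinear; rewrite divr_gt0.
Qed.

Lemma expRN_le_powR c t : 0 < c -> 0 < t ->
  expR (- t) <= c `^ c * expR 1 * (1 + t) `^ (- c).
Proof.
move=> c0 t0; have t1 : 0 < 1 + t by lra.
rewrite expRN powRN ler_pdivlMr ?powR_gt0 // ler_pdivrMl ?expR_gt0 //.
by rewrite mulrC -mulrA -expRD powR_le_expR.
Qed.

Let u (n : nat) : R := harmonic n.
Let v (n : nat) : R := n.+2%:R.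
Let D : set R := `]0, +oo[%classic.

Let uv n : u n < v n.
Proof.
apply: (@le_lt_trans _ _ 1); last by rewrite ltr1n.
by rewrite /u /= invf_le1 ?ltr0n // ler1n.
Qed.

Let uD : nonincreasing_seq u. Proof. exact: harmonic_nincr. Qed.

Let vD : nondecreasing_seq v. Proof. by move=> m n mn; rewrite ler_nat. Qed.

Let D_gt0 x : D x -> 0 < x.
Proof. by rewrite /D /= in_itv /= andbT. Qed.

Let DE : D = \bigcup_n `[u n, v n]%classic.
Proof.
apply/seteqP; split=> x.
  move=> /D_gt0 x0; have [n nh] := harmonic_small x0.
  have xV : 0 < x^-1 by rewrite invr_gt0.
  have [m mh] := harmonic_small xV.
  exists (maxn n m) => //=; rewrite in_itv /=; apply/andP; split.
    exact/ltW/nh/leq_maxl.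
  have := mh _ (leq_maxr n m); rewrite ltf_pV2 ?posrE // => /ltW xm.
  by apply: (le_trans xm); rewrite ler_nat.
move=> [n _]; rewrite /D /= !in_itv /= andbT => /andP[un _].
exact: lt_le_trans (harmonic_gt0 n) un.
Qed.

Definition gamma_integrand x t : R := t `^ (x - 1) * expR (- t).

Lemma is_derive_powR_expRN x t : 0 < t ->
  is_derive t 1 (fun t => t `^ x * expR (- t))
    (x * gamma_integrand x t - gamma_integrand (x + 1) t).
Proof.
move=> t0; have dN : is_derive t 1 (fun t : R => - t) (-1 : R).
  exact: is_deriveNid.
have dE := @is_derive1_comp _ expR (fun t => - t) t _ _
  (is_derive_expR (- t)) dN.
apply: (@trigger_derive _ _ _ _ _ (is_deriveM (is_derive1_powR x t0) dE)).
by rewrite /GRing.scale /= /gamma_integrand addrK; ring.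
Qed.

Lemma gamma_integrand_continuous x t : D t ->
  {for t, continuous (gamma_integrand x)}.
Proof.
move=> /D_gt0/(is_derive_powR_expRN (x - 1)); exact: is_derive_continuous.
Qed.

(** Up to a constant, the integrand is at most x t^(x-1) (1+t)^(-x-1), which is the
    derivative of the bounded function (t / (1+t))^x; this handles the
    singularity at 0 and the decay at infinity together. *)
Lemma integrable_gamma x : 0 < x ->
  mu.-integrable D (EFin \o gamma_integrand x).
Proof.
move=> x0; have mD : measurable D by exact: measurable_itv.
pose g t := x * t `^ (x - 1) * (1 + t) `^ (- (x + 1)).
have dg t : D t -> is_derive t 1 (fun t => t `^ x * (1 + t) `^ (- x)) (g t).
  move=> /D_gt0 t0; have t1 : -1 < t by lra.
  apply: (@trigger_derive _ _ _ _ _ (is_deriveM (is_derive1_powR x t0)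
    (is_derive_1Dx_powR (- x) t1))).
  rewrite /GRing.scale /= /g opprD !powR_subr1; [|lra..].
  field; apply/andP; split; lra.
have gc t : D t -> {for t, continuous g}.
  move=> /D_gt0 t0; have t1 : -1 < t by lra.
  exact: is_derive_continuous (is_deriveM (is_deriveM (is_derive_cst x t 1)
    (is_derive1_powR (x - 1) t0)) (is_derive_1Dx_powR (- (x + 1)) t1)).
have ig : mu.-integrable D (EFin \o g).
  apply: (@ge0_exhaust_integrable _ u v D uv uD vD DE _ _ gc dg 1)
    => t /D_gt0 t0.
    by rewrite /g !mulr_ge0 ?powR_ge0 // ltW.
  rewrite (ger0_norm (mulr_ge0 (powR_ge0 _ _) (powR_ge0 _ _))) powRN.
  rewrite ler_pdivrMr ?mul1r; last by apply: powR_gt0; lra.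
  by apply: ge0_ler_powR; rewrite ?nnegrE; lra.
pose K := (x + 1) `^ (x + 1) * expR 1 / x.
have iKg : mu.-integrable D (fun t => K%:E * (EFin \o g) t)%E.
  exact: integrableZl.
apply: le_integrable iKg => //.
  apply/measurable_EFinP; apply: (exhaust_measurable_fun DE) => t.
  exact: gamma_integrand_continuous.
move=> t /D_gt0 t0 /=; rewrite lee_fin.
have Kg : K * g t =
    t `^ (x - 1) * ((x + 1) `^ (x + 1) * expR 1 * (1 + t) `^ (- (x + 1))).
  by rewrite /K /g; field; rewrite gt_eqF.
rewrite !ger0_norm ?Kg ?mulr_ge0 ?powR_ge0 ?expR_ge0 //.
by rewrite /gamma_integrand ler_wpM2l ?powR_ge0 // expRN_le_powR //; lra.
Qed.

(** Integration by parts: t^x e^(-t) vanishes at 0 and at infinity. *)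
Lemma GammaD1 x : 0 < x -> Gamma (x + 1) = x * Gamma x.
Proof.
move=> x0; have mD : measurable D by exact: measurable_itv.
have x1 : 0 < x + 1 by lra.
have i0 := integrable_gamma x0; have i1 := integrable_gamma x1.
have i2 : mu.-integrable D (EFin \o (fun t => x * gamma_integrand x t)).
  exact: (@integrableZl _ _ _ mu D mD x _ i0).
suff : Rintegral mu D
    (fun t => x * gamma_integrand x t - gamma_integrand (x + 1) t) = 0.
  rewrite RintegralB // RintegralZl // => /eqP.
  by rewrite subr_eq0 => /eqP.
apply: (@exhaust_Rintegral _ u v D uv uD vD DE _
  (fun t => t `^ x * expR (- t))).
- move=> t Dt; apply: continuousB; last exact: gamma_integrand_continuous.
  by apply: continuousM; [exact: cvg_cst | exact: gamma_integrand_continuous].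
- move=> t /D_gt0; exact: is_derive_powR_expRN.
- exact: (@integrableB _ _ _ mu D mD _ _ i2 i1).
rewrite -[X in _ --> X]subr0; apply: cvgB.
- pose K := (x + 1) `^ (x + 1) * expR 1.
  have K0 : 0 <= K by rewrite mulr_ge0 ?powR_ge0 ?expR_ge0.
  have hK : K * harmonic n @[n --> \oo] --> (0 : R).
    by rewrite -(mulr0 K); apply: cvgMr; exact: cvg_harmonic.
  apply: (squeeze_cvgr _ (cvg_cst 0) hK); apply: nearW => n.
  rewrite mulr_ge0 ?powR_ge0 ?expR_ge0 //=.
  have v0 : 0 < v n by rewrite ltr0n.
  have v1 : 0 < 1 + v n by lra.
  apply: (@le_trans _ _ ((v n) `^ x * (K * (1 + v n) `^ (- (x + 1))))).
    by rewrite ler_wpM2l ?powR_ge0 // expRN_le_powR.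
  rewrite mulrCA ler_wpM2l // opprD powR_subr1 // mulrA powRN.
  apply: (@le_trans _ _ (1 + v n)^-1).
    rewrite ler_piMl ?invr_ge0 ?(ltW v1) // ler_pdivrMr ?powR_gt0 // mul1r.
    by apply: ge0_ler_powR; rewrite ?nnegrE; lra.
  by rewrite lef_pV2 ?posrE // ?ltr0n // /v -natr1 -natr1; lra.
- apply: (squeeze_cvgr _ (cvg_cst 0) (cvg_harmonic_powR x0)); apply: nearW => n.
  rewrite mulr_ge0 ?powR_ge0 ?expR_ge0 //= ler_piMr ?powR_ge0 // expR_le1.
  by rewrite oppr_le0 harmonic_ge0.
Qed.

End GammaFunction.

(** * Orthogonality implies the differential equation *)

Section Orthogonality.
Variables (R : realType) (a b : R).
Hypotheses (a1 : -1 < a) (b1 : -1 < b).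
Notation mu := (@lebesgue_measure R).
Let D : set R := `]-1, 1[%classic.
Implicit Types p g : {poly R}.

Definition wint p : R := Rintegral mu D (fun x => p.[x] * jacobi_weight a b x).

Let mD : measurable D. Proof. exact: measurable_itv. Qed.

Let ip p := integrable_poly_weight p a1 b1.

Lemma wintD p g : wint (p + g) = wint p + wint g.
Proof.
rewrite /wint -RintegralD //; [|exact: ip..].
by apply: eq_Rintegral => x _; rewrite hornerD mulrDl.
Qed.

Lemma wintZ c p : wint (c *: p) = c * wint p.
Proof.
rewrite /wint -RintegralZl //.
by apply: eq_Rintegral => x _; rewrite hornerZ -mulrA.
Qed.

Lemma wintB p g : wint (p - g) = wint p - wint g.
Proof. by rewrite wintD -scaleN1r wintZ mulN1r. Qed.

Lemma roots_negligible p : p != 0 -> mu.-negligible [set x | root p x].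
Proof.
move=> p0; have -> : [set x | root p x] = [set` rootsR p].
  apply/seteqP; split => x /=; have /(_ x) := roots_on_rootsR p0;
    by rewrite in_itv /= => ->.
have cs : countable [set` rootsR p] by apply/finite_set_countable/finite_seq.
exists [set` rootsR p]; split => //.
  exact: countable_measurable.
exact: countable_lebesgue_measure0.
Qed.

(** A nonzero polynomial vanishes only on a negligible set, and the weight is
    positive. *)
Lemma wint_sqr_eq0 p : wint (p * p) = 0 -> p = 0.
Proof.
move=> I0; apply/eqP/negPn/negP => p0.
pose f x : R := (p * p).[x] * jacobi_weight a b x.
have fi : mu.-integrable D (EFin \o f) by exact: ip.
have f0 x : D x -> 0 <= f x.
  by move=> _; rewrite /f hornerM mulr_ge0 ?jacobi_weight_ge0 // -expr2 sqr_ge0.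
have : (\int[mu]_(x in D) `|(EFin \o f) x| = 0)%E.
  transitivity (\int[mu]_(x in D) (EFin \o f) x)%E.
    by apply: eq_integral => x /set_mem Dx /=; rewrite ger0_norm ?f0.
  rewrite -[LHS]fineK; first by rewrite [fine _]I0.
  exact: integrable_fin_num.
move/(ae_eq_integral_abs mu mD (measurable_int _ fi)) => ae0.
have : mu.-negligible D.
  apply: negligibleS (negligibleU ae0 (roots_negligible p0)).
  move=> x Dx /=; have [rx|rx] := boolP (root p x); first by right.
  left => /(_ Dx) /= [] /eqP; rewrite mulf_eq0 hornerM mulf_eq0 orbb.
  rewrite -[p.[x] == 0]/(root p x) (negbTE rx) gt_eqF //.
  exact/jacobi_weight_gt0/itvN11_bounds.
move=> nD; have /eqP : mu D = 0 by apply: measure_negligible.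
rewrite /D lebesgue_measure_itv /= lte_fin.
have -> : (-1 < 1 :> R) by lra.
rewrite -EFinB eqe => /eqP; lra.
Qed.

Lemma coef_wdiv_deriv g j : (wdiv a b g^`())`_j =
  g`_j.+2 * j.+2%:R * j.+1%:R + (b - a) * (g`_j.+1 * j.+1%:R)
  - (j%:R * (j%:R - 1) + (a + b + 2) * j%:R) * g`_j.
Proof.
rewrite /wdiv !mulrBl mul1r -[_%:P * 'X * _]mulrA coefD !coefB !coefCM.
rewrite (mulrC 'X^2) (mulrC 'X) coefMXn coefMX !coef_deriv.
case: j => [|[|j]] //=; rewrite ?subn2 /= ?coef_deriv; ring.
Qed.

Lemma size_wdiv_deriv g n : (size g <= n)%N -> (size (wdiv a b g^`())%R <= n)%N.
Proof.
move=> gn; apply/leq_sizeP => j nj; have gj k : (n <= k)%N -> g`_k = 0.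
  by move=> nk; rewrite nth_default // (leq_trans gn).
rewrite coef_wdiv_deriv (gj j) // (gj j.+1) ?(gj j.+2) ?leqW //.
by rewrite !(mul0r, mulr0) addr0 subr0.
Qed.

(** The Jacobi operator is symmetric because the difference of the two integrands
    is the weighted divergence of p' g - p g'. *)
Lemma wint_wdiv_sym p g :
  wint (wdiv a b p^`() * g) = wint (p * wdiv a b g^`()).
Proof.
apply/eqP; rewrite -subr_eq0 -wintB; apply/eqP.
rewrite -(Rintegral_wdiv (p^`() * g - p * g^`()) a1 b1) /wint.
by congr (Rintegral _ _ _); apply/funext => x; congr (_.[x] * _);
  rewrite /wdiv derivB !derivM; ring.
Qed.

Lemma orthogonal_lower (P : nat -> {poly R}) n g :
  (forall j, size (P j) = j.+1) ->
  (forall i j, i <> j -> wint (P i * P j) = 0) ->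
  (size g <= n)%N -> wint (P n * g) = 0.
Proof.
move=> sP oP; suff H m : (m <= n)%N ->
    forall g, (size g <= m)%N -> wint (P n * g) = 0 by exact: H.
elim: m => [_ h|m IH mn h hm].
  rewrite leqn0 size_poly_eq0 => /eqP ->.
  by rewrite mulr0 -(scale0r 0) wintZ mul0r.
have Pm0 : (P m)`_m != 0.
  have := lead_coef_eq0 (P m).
  by rewrite lead_coefE sP /= -size_poly_eq0 sP => ->.
pose c := h`_m / (P m)`_m.
have -> : P n * h = P n * (h - c *: P m) + c *: (P n * P m).
  by rewrite mulrBr -scalerAr subrK.
rewrite wintD wintZ oP; last by move=> nm; rewrite nm ltnn in mn.
rewrite mulr0 addr0; apply: IH; first exact: ltnW.
apply/leq_sizeP => j; rewrite leq_eqVlt coefB coefZ => /predU1P[<-|mj].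
  by rewrite /c divfK // subrr.
by rewrite !nth_default ?sP ?mulr0 ?subr0 // (leq_trans hm).
Qed.

Definition jacobi_ev n : R := n%:R * (n%:R + a + b + 1).

(** The left-hand side r of the equation has degree less than n, the value of the
    eigenvalue being chosen to cancel the leading coefficient; by symmetry of the
    operator r is orthogonal to all polynomials of degree less than n, hence to
    itself. *)
Lemma orthogonal_eq (P : nat -> {poly R}) n :
  (forall j, size (P j) = j.+1) ->
  (forall i j, i <> j -> wint (P i * P j) = 0) ->
  jacobi_eq a b (jacobi_ev n) (P n).
Proof.
move=> sP oP; rewrite /jacobi_eq; set r := _ + _; have rn : (size r <= n)%N.
  apply/leq_sizeP => j; rewrite coefD coefZ coef_wdiv_deriv.
  have y0 k : (n < k)%N -> (P n)`_k = 0 by move=> nk; rewrite nth_default // sP.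
  rewrite leq_eqVlt => /predU1P[<-|nj].
    rewrite (y0 n.+1) // (y0 n.+2) // /jacobi_ev; ring.
  by rewrite !y0 // ?leqW // ?ltnW //; ring.
apply: wint_sqr_eq0; rewrite {1}/r mulrDl wintD -scalerAl wintZ.
rewrite wint_wdiv_sym !(orthogonal_lower sP oP) ?mulr0 ?addr0 //.
exact: size_wdiv_deriv.
Qed.

End Orthogonality.

Lemma Rintegral_cc_oo (R : realType) (f : R -> R) :
  measurable_fun (`]-1, 1[%classic : set R) f ->
  Rintegral (@lebesgue_measure R) `[-1, 1] f =
  Rintegral (@lebesgue_measure R) `]-1, 1[ f.
Proof.
move=> mf; rewrite /Rintegral integral_itv_bndoo //; exact/measurable_EFinP.
Qed.

Lemma jacobi_ode (R : realType) (a b : R) P n : -1 < a -> -1 < b ->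
  is_jacobi a b P -> jacobi_eq a b (jacobi_ev a b n) (P n).
Proof.
move=> a1 b1 [sP oP _]; apply: orthogonal_eq => // i j /oP <-.
rewrite Rintegral_cc_oo.
  by apply: eq_Rintegral => x _; rewrite hornerM.
apply: measurable_funM; last exact: jacobi_weight_measurable.
by apply: measurable_funM; exact: measurable_poly.
Qed.

(** * Harmonic sums, eigenvalues, and the values at 1 *)

Section Harmonic.
Variable R : realType.

Lemma ln_le_harmonic n : ln n.+1%:R <= \sum_(k < n) harmonic k :> R.
Proof.
elim: n => [|n IH]; first by rewrite big_ord0 ln1.
rewrite big_ord_recr /=; have n0 : 0 < n.+1%:R :> R by rewrite ltr0n.
have -> : n.+2%:R = n.+1%:R * (1 + n.+1%:R^-1) :> R.
  by rewrite mulrDr mulr1 mulfV ?gt_eqF // natr1.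
have h0 : 0 < n.+1%:R^-1 :> R by rewrite invr_gt0.
rewrite lnM ?posrE ?addr_gt0 //.
by apply: lerD => //; apply: le_ln1Dx; apply: lt_trans h0; rewrite ltrN10.
Qed.

Lemma harmonic_le_ln n : \sum_(k < n.+1) harmonic k <= 1 + ln n.+1%:R :> R.
Proof.
elim: n => [|n IH]; first by rewrite big_ord_recr big_ord0 /= ln1 invr1; lra.
rewrite big_ord_recr /=.
have n0 : 0 < n.+2%:R :> R by rewrite ltr0n.
have n1 : 0 < n.+1%:R :> R by rewrite ltr0n.
have h1 : n.+2%:R^-1 < 1 :> R by rewrite invf_lt1 // ltr1n.
have E : n.+1%:R = n.+2%:R * (1 - n.+2%:R^-1) :> R.
  by rewrite mulrBr mulr1 mulfV ?gt_eqF // -[n.+2%:R]natr1 addrK.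
have hl : ln (1 - n.+2%:R^-1) <= - n.+2%:R^-1 :> R.
  by apply: le_ln1Dx; rewrite ltrN2.
have : ln n.+1%:R = ln n.+2%:R + ln (1 - n.+2%:R^-1) :> R.
  by rewrite -lnM ?posrE ?subr_gt0 // -E.
move=> lnE; rewrite -lerBrDr; apply: (le_trans IH).
by rewrite lnE -addrA !lerD2l.
Qed.

(** For a row eigenvector x, put S = sum_i |x_i| w_i.  The eigenvalue equation
    gives c |x_j| <= K S w_j; multiply by w_j and sum over j to get
    c S <= K S sum_j w_j^2, where S > 0. *)
Lemma eigenvalue_le_weights n (G : 'M[R]_n) (w : 'I_n -> R) (K c : R) :
  (forall i, 0 < w i) -> (forall i j, `|G i j| <= K * (w i * w j)) ->
  eigenvalue G c -> c <= K * \sum_i w i ^+ 2.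
Proof.
move=> w0 GK /eigenvalueP[x xG x0].
pose S := \sum_i `|x 0 i| * w i.
have S0 : 0 < S.
  rewrite lt_neqAle sumr_ge0 ?andbT => [|i _]; last by rewrite mulr_ge0 // ltW.
  apply/eqP => /esym/psumr_eq0P; move/eqP: x0 => x0; apply: contra_not x0 => H.
  apply/rowP => i; rewrite mxE; apply/eqP; rewrite -normr_eq0.
  have /eqP := H (fun i _ => mulr_ge0 (normr_ge0 _) (ltW (w0 i))) i isT.
  by rewrite mulf_eq0 (gt_eqF (w0 i)) orbF.
rewrite -(ler_pM2r S0).
apply: (@le_trans _ _ (\sum_j (K * S * w j ^+ 2))); last first.
  by rewrite -mulr_sumr mulrAC.
rewrite mulr_sumr; apply: ler_sum => j _.
rewrite mulrA expr2 mulrA ler_wpM2r ?(ltW (w0 j)) //.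
apply: (@le_trans _ _ `|c * x 0 j|).
  by rewrite normrM ler_wpM2r // ler_norm.
have -> : c * x 0 j = (x *m G) 0 j by rewrite xG mxE.
rewrite mxE; apply: (le_trans (ler_norm_sum _ _ _)).
rewrite /S mulrAC mulr_sumr; apply: ler_sum => i _; rewrite normrM.
rewrite [X in _ <= X](_ : _ = `|x 0 i| * (K * (w i * w j))); last by ring.
by rewrite ler_wpM2l.
Qed.

(** Consecutive values at 1 have ratio 1 + a/(n+1) <= exp (a/(n+1)), so the n-th
    value is at most a constant times exp (a H_n), with H_n the harmonic number.
    Both bounds on H_n are used, according to the sign of a. *)
Lemma jacobi_at1_le (a : R) : -1 < a -> exists2 K : R, 0 <= K &
  forall b P, is_jacobi a b P ->
    forall n, (P n).[1] ^+ 2 <= K * n.+1%:R `^ (2 * a).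
Proof.
move=> a1; pose y (n : nat) : R :=
  Gamma (n%:R + a + 1) / (Gamma (n%:R + 1) * Gamma (a + 1)).
have yS n : y n.+1 = y n * (1 + a / n.+1%:R).
  rewrite /y -natr1.
  have n0 : 0 <= n%:R :> R by rewrite ler0n.
  have -> : n%:R + 1 + a + 1 = (n%:R + a + 1) + 1 by ring.
  rewrite (@GammaD1 _ (n%:R + a + 1)); last lra.
  rewrite (@GammaD1 _ (n%:R + 1)); last lra.
  move: (Gamma _) (Gamma _) (Gamma _) => g1 g2 g3; rewrite !invfM.
  have -> : 1 + a / (n%:R + 1) = (n%:R + a + 1) / (n%:R + 1) by field; lra.
  by ring.
have yb n : `|y n| <= `|y 0%N| * expR (a * \sum_(k < n) harmonic k).
  elim: n => [|n IH]; first by rewrite big_ord0 mulr0 expR0 mulr1.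
  have n0 : 0 < n.+1%:R :> R by rewrite ltr0n.
  rewrite yS normrM big_ord_recr /= [a * (_ + _)]mulrDr expRD mulrA.
  rewrite ler_pM // ger0_norm ?expR_ge1Dx //.
  have -> : 1 + a / n.+1%:R = (n.+1%:R + a) / n.+1%:R by field; lra.
  apply: divr_ge0; last exact: ltW.
  have : 1 <= n.+1%:R :> R by rewrite ler1n.
  lra.
exists ((`|y 0%N| * expR `|a|) ^+ 2); first exact: sqr_ge0.
move=> b P [_ _ P1] n; rewrite P1 -/(y n) -real_normK ?num_real //.
have n0 : 0 < n.+1%:R :> R by rewrite ltr0n.
have -> : n.+1%:R `^ (2 * a) = (n.+1%:R `^ a) ^+ 2 :> R.
  by rewrite mulrC powRrM powR_mulrn // powR_ge0.
rewrite -exprMn ler_sqr ?nnegrE ?mulr_ge0 ?expR_ge0 ?powR_ge0 //.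
apply: (le_trans (yb n)); rewrite -mulrA ler_wpM2l //.
rewrite /powR gt_eqF // -expRD ler_expR.
have [h0|h0] := leP 0 a.
  rewrite ger0_norm //.
  case: n n0 {yS yb} => [|n] n0; first by rewrite big_ord0 ln1 !mulr0 addr0.
  rewrite -[X in X + _]mulr1 -mulrDr ler_wpM2l //.
  apply: (le_trans (harmonic_le_ln n)); rewrite lerD2l ler_ln ?posrE ?ltr0n //.
  by rewrite ler_nat.
rewrite ler_wpDl // ler_wnM2l ?(ltW h0) //; exact: ln_le_harmonic.
Qed.

End Harmonic.

(** * Sonin's energy *)

Section Energy.
Variable R : realType.
Implicit Types a b l x u v z : R.
Implicit Types y : {poly R}.

Lemma ge0_is_derive_le (f df : R -> R) u v : u <= v ->
  (forall x, u <= x <= v -> is_derive x 1 f (df x)) ->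
  (forall x, u <= x <= v -> 0 <= df x) -> f u <= f v.
Proof.
move=> uv dF df0; have [||c] := @MVT_segment _ f df u v uv.
- by move=> x; rewrite in_itv /= => /andP[ux xv]; apply: dF; rewrite !ltW.
- apply: continuous_in_subspaceT => x /set_mem; rewrite /= in_itv /= => /dF.
  exact: is_derive_continuous.
rewrite in_itv /= => /df0 d0 E.
by rewrite -subr_ge0 E mulr_ge0 // subr_ge0.
Qed.

Definition poly_deriv := (@derivD, @derivN, @derivM, @derivZ, @derivXn, @derivX,
  @derivC).

(** The coefficient q of y' in Jacobi's equation once it is written as
    s y'' + (q - x) y' + l y = 0; the energy dissipates where q > 0. *)
Definition friction a b x : R := b - a - (a + b + 1) * x.

Lemma jacobi_eqP a b l y x : jacobi_eq a b l y ->
  (1 - x ^+ 2) * y^`()^`().[x] + (friction a b x - x) * y^`().[x]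
  + l * y.[x] = 0.
Proof.
move=> /(congr1 (horner^~ x)); rewrite /wdiv !poly_horner => <-.
by rewrite /friction; ring.
Qed.

(** The derivative of a Jacobi polynomial is, up to a factor, a Jacobi polynomial
    with both exponents raised by 1. *)
Lemma jacobi_eq_deriv a b l y : jacobi_eq a b l y ->
  jacobi_eq (a + 1) (b + 1) (l - (a + b + 2)) y^`().
Proof.
move=> /(congr1 (@deriv R)); rewrite /jacobi_eq /wdiv deriv0 => <-.
rewrite !poly_deriv -!mul_polyC !(polyCD, polyCN) polyC1 /=; ring.
Qed.

(** Sonin's function. *)
Definition energy l y : {poly R} := l *: (y ^+ 2) + (1 - 'X^2) * y^`() ^+ 2.

Lemma energyE l y x :
  (energy l y).[x] = l * y.[x] ^+ 2 + (1 - x ^+ 2) * y^`().[x] ^+ 2.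
Proof. by rewrite /energy !(poly_horner, horner_exp). Qed.

Lemma deriv_energy a b l y x : jacobi_eq a b l y ->
  (energy l y)^`().[x] = - 2 * friction a b x * y^`().[x] ^+ 2.
Proof.
move=> /(jacobi_eqP x) E; rewrite /energy !expr2 !poly_deriv !poly_horner /=.
apply/eqP; rewrite -subr_eq0; apply/eqP.
transitivity (2 * y^`().[x] * ((1 - x ^+ 2) * y^`()^`().[x]
  + (friction a b x - x) * y^`().[x] + l * y.[x])); last by rewrite E mulr0.
by rewrite /friction; ring.
Qed.

Lemma energy_ge l y x : -1 <= x <= 1 -> l * y.[x] ^+ 2 <= (energy l y).[x].
Proof.
move=> /andP[x1 x2]; rewrite energyE lerDl mulr_ge0 ?sqr_ge0 //; nra.
Qed.

Lemma energy_ge0 l y x : 0 <= l -> -1 <= x <= 1 -> 0 <= (energy l y).[x].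
Proof.
move=> l0 /(energy_ge l y); apply: le_trans; by rewrite mulr_ge0 ?sqr_ge0.
Qed.

Lemma energy1 l y : (energy l y).[1] = l * y.[1] ^+ 2.
Proof. by rewrite energyE expr1n subrr mul0r addr0. Qed.

Lemma energyN1 l y : (energy l y).[-1] = l * y.[-1] ^+ 2.
Proof. by rewrite energyE sqrrN expr1n subrr mul0r addr0. Qed.

Lemma energy_right_le a b l y u : jacobi_eq a b l y -> 0 < a + b + 1 ->
  u <= 1 -> friction a b u <= 0 -> (energy l y).[u] <= l * y.[1] ^+ 2.
Proof.
move=> E s0 u1 tu; rewrite -energy1.
apply: (ge0_is_derive_le u1 (fun x _ => is_derive_poly _ x)) => x /andP[ux _].
rewrite (deriv_energy x E) mulr_ge0 ?sqr_ge0 //.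
move: tu; rewrite /friction => tu; nra.
Qed.

Lemma energy_left_le a b l y u : jacobi_eq a b l y -> 0 < a + b + 1 ->
  -1 <= u -> 0 <= friction a b u -> (energy l y).[u] <= l * y.[-1] ^+ 2.
Proof.
move=> E s0 u1 tu; rewrite -energyN1 -lerN2.
have D x : is_derive x 1 (fun x => - (energy l y).[x]) (- (energy l y)^`().[x]).
  exact: is_deriveN.
apply: (ge0_is_derive_le u1 (fun x _ => D x)) => x /andP[_ xu].
rewrite (deriv_energy x E) mulNr mulNr opprK mulr_ge0 ?sqr_ge0 //.
move: tu; rewrite /friction => tu; nra.
Qed.

(** As q <= (b + 1/2)(1-x), the energy dissipates at rate at most
    (2b+1) / (1+x). *)
Lemma energy_growth a b l y u v : - (1 / 2) < a -> - (1 / 2) < b ->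
  jacobi_eq a b l y -> 0 <= l -> -1 < u -> u <= v -> v <= 1 ->
  (energy l y).[u] * (1 + u) `^ (2 * b + 1) <=
  (energy l y).[v] * (1 + v) `^ (2 * b + 1).
Proof.
move=> ha hb E l0 u1 uv v1.
apply: (@ge0_is_derive_le (fun x => (energy l y).[x] * (1 + x) `^ (2 * b + 1))
  _ u v uv).
  move=> x /andP[ux xv]; have x1 : -1 < x by lra.
  exact: (is_deriveM (is_derive_poly (energy l y) x)
    (is_derive_1Dx_powR (2 * b + 1) x1)).
move=> x /andP[ux xv] /=; have x0 : 0 < 1 + x by lra.
rewrite /GRing.scale /= (deriv_energy x E) energyE powR_subr1 //.
have W0 := powR_gt0 (2 * b + 1) x0; set W := _ `^ _ in W0 *.
rewrite [X in 0 <= X](_ : _ = W / (1 + x) * ((2 * b + 1) * (l * y.[x] ^+ 2)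
   + (2 * a + 1) * ((1 + x) ^+ 2 * y^`().[x] ^+ 2))).
  have b0 : 0 <= 2 * b + 1 by lra.
  have a0 : 0 <= 2 * a + 1 by lra.
  apply: mulr_ge0; first exact: divr_ge0 (ltW W0) (ltW x0).
  by rewrite addr_ge0 // mulr_ge0 // mulr_ge0 // sqr_ge0.
rewrite /friction; field; lra.
Qed.

(** * Near conservation of the weighted energy *)

(** This is s times F + q y y' - r y^2 / 2, with F the energy and
    r = x q / s - (a+b+1).  In the derivative of W F the terms of the order of F
    are those of - (W q y y')'; what remains is W r y y', which is in turn the
    derivative of W r y^2 / 2 up to a multiple of y^2.  The factor s makes the
    expression a polynomial, and lowers the exponents of the accompanying weight
    from a + 1/2 and b + 1/2 to a - 1/2 and b - 1/2. *)
Definition liouville_energy a b l y : {poly R} :=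
  let q := (b - a)%:P - (a + b + 1)%:P * 'X in
  l *: ((1 - 'X^2) * y ^+ 2) + (1 - 'X^2) ^+ 2 * y^`() ^+ 2
  + (1 - 'X^2) * q * y * y^`()
  - 2^-1 *: (('X * q - (a + b + 1) *: (1 - 'X^2)) * y ^+ 2).

Lemma liouville_energyE a b l y x : (liouville_energy a b l y).[x] =
  l * (1 - x ^+ 2) * y.[x] ^+ 2 + (1 - x ^+ 2) ^+ 2 * y^`().[x] ^+ 2
  + (1 - x ^+ 2) * friction a b x * y.[x] * y^`().[x]
  - (x * friction a b x - (a + b + 1) * (1 - x ^+ 2)) * y.[x] ^+ 2 / 2.
Proof.
by rewrite /liouville_energy /friction !(poly_horner, horner_exp); field.
Qed.

(** Equals s (s r' + r q), for r as in [liouville_energy]. *)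
Definition liouville_defect a b x : R :=
  let s := 1 - x ^+ 2 in let q := friction a b x in
  s * (q - (a + b + 1) * x - (a + b + 1) * q) + 2 * x ^+ 2 * q + x * q ^+ 2.

(** The left-hand side is (w H)' / w, for H = [liouville_energy] and w the weight
    with exponents a - 1/2 and b - 1/2.  That only a term in y^2 is left is what
    the corrections in H are for. *)
Lemma deriv_liouville_energy a b l y x : jacobi_eq a b l y -> -1 < x < 1 ->
  (liouville_energy a b l y)^`().[x]
  + ((b - 2^-1) / (1 + x) - (a - 2^-1) / (1 - x))
    * (liouville_energy a b l y).[x] =
  - (liouville_defect a b x / (1 - x ^+ 2) * y.[x] ^+ 2 / 2).
Proof.
move=> /(jacobi_eqP x) E /andP[x1 x2].
have s0 : 1 - x ^+ 2 != 0.
  have -> : 1 - x ^+ 2 = (1 - x) * (1 + x) by ring.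
  by rewrite mulf_neq0 // gt_eqF //; lra.
have {E} Y2 : y^`()^`().[x] =
    - ((friction a b x - x) * y^`().[x] + l * y.[x]) / (1 - x ^+ 2).
  apply: (mulfI s0); rewrite mulrC [RHS]mulrC divfK // mulrC.
  by move/eqP: E; rewrite -addrA addr_eq0 => /eqP.
rewrite liouville_energyE /liouville_energy !expr2 !poly_deriv !poly_horner.
rewrite {}Y2 /liouville_defect /friction.
field; rewrite -expr2 s0 /=; apply/andP; split; lra.
Qed.


Definition friction_bound a b : R := `|b - a| + (a + b + 1).

(** The energy estimates hold where l (1 - x^2) is at least this constant, that
    is, outside layers of width of the order of 1 / l at the endpoints. *)
Definition layer a b : R := friction_bound a b ^+ 2 + 2 * friction_bound a b.

Lemma friction_bound_gt0 a b : 0 < a + b + 1 -> 0 < friction_bound a b.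
Proof. by move=> s0; rewrite /friction_bound ltr_wpDl. Qed.

Lemma layer_gt0 a b : 0 < a + b + 1 -> 0 < layer a b.
Proof.
move=> /friction_bound_gt0 k0.
by rewrite /layer addr_gt0 ?exprn_gt0 ?mulr_gt0.
Qed.

Lemma friction_le a b x : 0 < a + b + 1 -> -1 <= x <= 1 ->
  `|friction a b x| <= friction_bound a b.
Proof.
move=> s0 /andP[x1 x2]; rewrite /friction /friction_bound.
rewrite (le_trans (ler_normB _ _)) // lerD2l normrM gtr0_norm //.
rewrite ler_piMr ?(ltW s0) // ler_norml; apply/andP; split; lra.
Qed.

(** The cross term s q y y' is at most half of s^2 y'^2 + q^2 y^2, and the terms
    in y^2 without the factor l are absorbed by l s y^2. *)
Lemma liouville_energy_bounds a b l y x :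
  0 < a + b + 1 -> 0 < l -> -1 < x < 1 -> layer a b <= l * (1 - x ^+ 2) ->
  (1 - x ^+ 2) * (energy l y).[x] / 2 <= (liouville_energy a b l y).[x]
    <= 2 * ((1 - x ^+ 2) * (energy l y).[x]).
Proof.
move=> s0 l0 /andP[x1 x2]; rewrite liouville_energyE energyE /layer.
have := @friction_le a b x s0; rewrite (ltW x1) (ltW x2) => /(_ isT).
have sk : a + b + 1 <= friction_bound a b by rewrite /friction_bound lerDr.
have k0 := friction_bound_gt0 s0; move: (friction_bound a b) k0 sk => k k0 sk.
move: (friction a b x) => q qk.
move: qk; rewrite ler_norml => /andP[q1 q2].
have qq : q ^+ 2 <= k ^+ 2 by nra.
set s := 1 - x ^+ 2; have sp : 0 < s by rewrite /s; nra.
have s1 : s <= 1 by rewrite /s gerBl sqr_ge0.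
have r1 : x * q - (a + b + 1) * s <= 2 * k by nra.
have r2 : - (2 * k) <= x * q - (a + b + 1) * s by nra.
move: (x * q - _) r1 r2 => r r1 r2 ls.
move: (y.[x]) (y^`().[x]) => Y Z.
have YY := sqr_ge0 Y.
have c1 : (k ^+ 2 + 2 * k) * Y ^+ 2 <= l * s * Y ^+ 2 by rewrite ler_wpM2r.
have c2 : q ^+ 2 * Y ^+ 2 <= k ^+ 2 * Y ^+ 2 by rewrite ler_wpM2r.
have c3 : r * Y ^+ 2 <= 2 * k * Y ^+ 2 by rewrite ler_wpM2r.
have c4 : - (2 * k) * Y ^+ 2 <= r * Y ^+ 2 by rewrite ler_wpM2r.
have c5 := sqr_ge0 (s * Z + q * Y); have c6 := sqr_ge0 (s * Z - q * Y).
apply/andP; split; nra.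
Qed.

Lemma liouville_defect_le a b x : 0 < a + b + 1 -> -1 <= x <= 1 ->
  `|liouville_defect a b x| <= 2 * layer a b.
Proof.
move=> s0 x12; have qk := friction_le s0 x12; have /andP[x1 x2] := x12.
have sk : a + b + 1 <= friction_bound a b by rewrite /friction_bound lerDr.
have k0 := friction_bound_gt0 s0; rewrite /liouville_defect /layer.
move: (friction_bound a b) k0 sk qk => k k0 sk; move: (friction a b x) => q qk.
set s := 1 - x ^+ 2; have sp : 0 <= s by rewrite /s; nra.
have s1 : s <= 1 by rewrite /s gerBl sqr_ge0.
have ax : `|x| <= 1 by rewrite ler_norml; apply/andP; split; lra.
have ax2 : `|x ^+ 2| <= 1 by rewrite normrX exprn_ile1.
have as1 : `|s| <= 1 by rewrite ger0_norm.
have asg : `|a + b + 1| <= k by rewrite gtr0_norm.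
have b1 : `|q - (a + b + 1) * x - (a + b + 1) * q| <= k + k + k * k.
  rewrite (le_trans (ler_normB _ _)) // normrM lerD ?ler_pM //.
  rewrite (le_trans (ler_normB _ _)) // lerD // normrM -[leRHS]mulr1 ler_pM //.
have b2 : `|s * (q - (a + b + 1) * x - (a + b + 1) * q)| <= 1 * (k + k + k * k).
  by rewrite normrM ler_pM.
have b3 : `|2 * x ^+ 2 * q| <= 2 * 1 * k.
  rewrite normrM [`|2 * _|]normrM normr_nat.
  by apply: ler_pM; rewrite ?mulr_ge0 ?ler_wpM2l.
have b4 : `|x * q ^+ 2| <= 1 * (k * k).
  by rewrite normrM ler_pM // expr2 normrM ler_pM.
apply: (le_trans (ler_normD _ _)).
apply: (le_trans (lerD (ler_normD _ _) (lexx _))).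
apply: (le_trans (lerD (lerD b2 b3) b4)).
nra.
Qed.

(** An integrating factor: its logarithmic derivative c (1/(1-x)^2 + 1/(1+x)^2)
    dominates the relative growth rate of the corrected energy, and for c = M / l
    the factor lies between exp (-1) and exp 1 at distance M / l or more from the
    endpoints. *)
Definition layer_factor c x : R := expR (c * ((1 - x)^-1 - (1 + x)^-1)).

Lemma is_derive_layer_factor c x : -1 < x < 1 ->
  is_derive x 1 (layer_factor c)
    (layer_factor c x * (c * ((1 - x) ^- 2 + (1 + x) ^- 2))).
Proof.
move=> /andP[x1 x2]; have n1 : 1 - x != 0 by rewrite gt_eqF // subr_gt0.
have n2 : 1 + x != 0 by rewrite gt_eqF //; lra.
have d1 : is_derive x 1 (fun t : R => 1 - t) (- 1 : R).
  by apply: is_derive_eq; ring.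
have d2 : is_derive x 1 (fun t : R => 1 + t) (1 : R).
  by apply: is_derive_eq; ring.
have D : is_derive x 1 (fun x => c * ((1 - x)^-1 - (1 + x)^-1))
    (c * ((1 - x) ^- 2 + (1 + x) ^- 2)).
  have v1 := @is_deriveV _ (fun t => 1 - t) _ _ _ n1 d1.
  have v2 := @is_deriveV _ (fun t => 1 + t) _ _ _ n2 d2.
  apply: (@trigger_derive _ _ _ _ _ (is_deriveM (is_derive_cst c x 1)
    (is_deriveB v1 v2))).
  by rewrite /GRing.scale /=; ring.
exact: (@is_derive1_comp _ expR (fun x => c * ((1 - x)^-1 - (1 + x)^-1)) x _ _
  (is_derive_expR _) D).
Qed.

Definition lyapunov a b l y x : R :=
  (liouville_energy a b l y).[x] * jacobi_weight (a - 2^-1) (b - 2^-1) x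
  * layer_factor (layer a b / l) x.

(** The derivative has the sign of c A H - d y^2 / (2 s), where c = M / l,
    A = 1/(1-x)^2 + 1/(1+x)^2 >= 2 / s^2, H >= l s y^2 / 2 is the corrected energy
    and d <= 2 M the defect; the two terms balance at M y^2 / s. *)
Lemma lyapunov_mono a b l y u v : jacobi_eq a b l y -> 0 < a + b + 1 -> 0 < l ->
  -1 < u -> u <= v -> v < 1 ->
  (forall x, u <= x <= v -> layer a b <= l * (1 - x ^+ 2)) ->
  lyapunov a b l y u <= lyapunov a b l y v.
Proof.
move=> E s0 l0 u1 uv v1 H.
have xI x : u <= x <= v -> -1 < x < 1.
  by move=> /andP[ux xv]; apply/andP; split; lra.
apply: (@ge0_is_derive_le (lyapunov a b l y) _ u v uv) => x xuv.
  have x12 := xI x xuv.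
  exact: (is_deriveM (is_deriveM (is_derive_poly (liouville_energy a b l y) x)
    (is_derive_jacobi_weight _ _ x12)) (is_derive_layer_factor _ x12)).
have x12 := xI x xuv.
have w0 := jacobi_weight_gt0 (a - 2^-1) (b - 2^-1) x12.
have e0 : 0 < layer_factor (layer a b / l) x by exact: expR_gt0.
have /andP[Hl _] := liouville_energy_bounds y s0 l0 x12 (H x xuv).
have D := deriv_liouville_energy E x12.
have /andP[x1 x2] := x12.
have x12' : -1 <= x <= 1 by rewrite !ltW.
have L0 := layer_gt0 s0; have T := liouville_defect_le s0 x12'.
have Fl := energy_ge l y x12'.
rewrite /GRing.scale /=.
set w := jacobi_weight _ _ _ in w0 *; set e := layer_factor _ _ in e0 *.
set A := (1 - x) ^- 2 + (1 + x) ^- 2.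
set h := (liouville_energy a b l y).[x] in Hl D *.
set h' := (liouville_energy a b l y)^`().[x] in D *.
rewrite -[(horner _ * _) x]/(h * w).
rewrite [X in 0 <= X](_ : _ = w * e *
  ((h' + ((b - 2^-1) / (1 + x) - (a - 2^-1) / (1 - x)) * h)
   + layer a b / l * A * h)); last by ring.
apply: mulr_ge0; first exact/ltW/mulr_gt0.
rewrite {}D.
set s := 1 - x ^+ 2 in Hl *.
have sp : 0 < s by rewrite /s; nra.
have AE : 2 / s ^+ 2 <= A.
  rewrite -subr_ge0 (_ : _ - _ = 2 * x ^+ 2 / s ^+ 2).
    by rewrite divr_ge0 ?sqr_ge0 // mulr_ge0 ?sqr_ge0.
  rewrite /A /s; field.
  by apply/and3P; split; rewrite ?gt_eqF //; lra.
move: (y.[x]) Fl => Y Fl; have YY := sqr_ge0 Y.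
have Hl' : s * (l * Y ^+ 2) / 2 <= h.
  by apply: le_trans Hl; rewrite ler_wpM2r // ler_wpM2l // ltW.
have c0 : 0 < layer a b / l by rewrite divr_gt0.
have lo : layer a b * Y ^+ 2 / s <= layer a b / l * A * h.
  rewrite (_ : _ / s = layer a b / l * (2 / s ^+ 2) * (s * (l * Y ^+ 2) / 2)).
    apply: ler_pM => //.
    - by rewrite mulr_ge0 ?(ltW c0) // divr_ge0 // sqr_ge0.
    - by rewrite divr_ge0 // mulr_ge0 ?(ltW sp) // mulr_ge0 // ltW.
    - by rewrite ler_wpM2l // ltW.
  by field; rewrite !gt_eqF.
rewrite addrC subr_ge0; apply: le_trans lo.
have -> : liouville_defect a b x / s * Y ^+ 2 / 2 =
    liouville_defect a b x / 2 * (Y ^+ 2 / s) by ring.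
rewrite -[layer a b * _ / s]mulrA ler_wpM2r ?divr_ge0 ?(ltW sp) //.
have := ler_norm (liouville_defect a b x); lra.
Qed.


Lemma energy_middle_le a b l y u v :
  jacobi_eq a b l y -> 0 < a + b + 1 -> 0 < l -> layer a b <= l ->
  -1 + layer a b / l <= u -> u <= v -> v <= 1 - layer a b / l ->
  (energy l y).[u] * jacobi_weight (a + 2^-1) (b + 2^-1) u <=
  4 * expR 2 * ((energy l y).[v] * jacobi_weight (a + 2^-1) (b + 2^-1) v).
Proof.
move=> E s0 l0 Ml uM uv vM; have M0 := layer_gt0 s0.
have d0 : 0 < layer a b / l by rewrite divr_gt0.
have d1 : layer a b / l <= 1 by rewrite ler_pdivrMr // mul1r.
have inside x : u <= x <= v -> -1 < x < 1.
  by move=> /andP[ux xv]; apply/andP; split; lra.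
have sl x : u <= x <= v -> layer a b <= l * (1 - x ^+ 2).
  move=> /andP[ux xv]; rewrite mulrC -ler_pdivrMr //.
  move: (layer a b / l) d0 d1 uM vM => d d0 d1 uM vM; nra.
have ui : u <= u <= v by rewrite lexx.
have vi : u <= v <= v by rewrite lexx andbT.
have /andP[u1 u2] := inside u ui; have /andP[v1 v2] := inside v vi.
have := lyapunov_mono E s0 l0 u1 uv v2 sl.
have /andP[Hu _] := liouville_energy_bounds y s0 l0 (inside u ui) (sl u ui).
have /andP[_ Hv] := liouville_energy_bounds y s0 l0 (inside v vi) (sl v vi).
rewrite !jacobi_weight_split ?inside // /lyapunov.
have wu := jacobi_weight_gt0 (a - 2^-1) (b - 2^-1) (inside u ui).
have wv := jacobi_weight_gt0 (a - 2^-1) (b - 2^-1) (inside v vi).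
have Ev : layer_factor (layer a b / l) v <= expR 1.
  rewrite /layer_factor ler_expR mulrBr lerBlDr.
  apply: (@le_trans _ _ 1); last by rewrite lerDl divr_ge0 // ?(ltW d0) //; lra.
  rewrite ler_pdivrMr; lra.
have Eu : expR (- 1) <= layer_factor (layer a b / l) u.
  rewrite /layer_factor ler_expR mulrBr.
  have : layer a b / l / (1 + u) <= 1 by rewrite ler_pdivrMr; lra.
  have : 0 <= layer a b / l / (1 - u) by rewrite divr_ge0 // ?(ltW d0) //; lra.
  lra.
move: (liouville_energy a b l y).[u] Hu => hu Hu.
move: (liouville_energy a b l y).[v] Hv => hv Hv.
have Fu := energy_ge0 y (ltW l0) (introT andP (conj (ltW u1) (ltW u2))).
have Fv := energy_ge0 y (ltW l0) (introT andP (conj (ltW v1) (ltW v2))).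
move: (jacobi_weight _ _ u) (jacobi_weight _ _ v) wu wv => Wu Wv wu wv.
have su : 0 < 1 - u ^+ 2 by nra.
have sv : 0 < 1 - v ^+ 2 by nra.
move=> K.
have A1 : (1 - u ^+ 2) * (energy l y).[u] / 2 * Wu * expR (- 1) <=
    hu * Wu * layer_factor (layer a b / l) u.
  apply: ler_pM; rewrite ?expR_ge0 //.
    by rewrite !mulr_ge0 // ltW.
  by rewrite ler_wpM2r // ltW.
have A2 : hv * Wv * layer_factor (layer a b / l) v <=
    2 * ((1 - v ^+ 2) * (energy l y).[v]) * Wv * expR 1.
  have hv0 : 0 <= 2 * ((1 - v ^+ 2) * (energy l y).[v]) * Wv.
    by rewrite !mulr_ge0 // ltW.
  apply: (@le_trans _ _ (2 * ((1 - v ^+ 2) * (energy l y).[v]) * Wv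
      * layer_factor (layer a b / l) v)).
    by rewrite ler_wpM2r ?expR_ge0 // ler_wpM2r // ltW.
  by rewrite ler_wpM2l.
have := le_trans A1 (le_trans K A2); rewrite -ler_pdivlMr ?expR_gt0 //.
rewrite expRN invrK => {}K.
have -> : expR 2 = expR 1 * expR 1 :> R by rewrite -expRD.
move: K; move: (expR 1) => e; lra.
Qed.

(** * The layer at -1 *)

(** y' has eigenvalue l - (a+b+2).  The energy of y' bounds y' if this is positive;
    when it is 0, which happens in degree 1, y' is constant. *)
Definition deriv_tame a b l y := (a + b + 2 < l) || (size y <= 2)%N.

Lemma deriv_sqr_le_left a b l y x : - (1 / 2) < a -> - (1 / 2) < b ->
  jacobi_eq a b l y -> deriv_tame a b l y ->
  -1 <= x -> (a + b + 3) * x <= b - a -> y^`().[x] ^+ 2 <= y^`().[-1] ^+ 2.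
Proof.
move=> ha hb E /orP[l1|sy] x1 x2; last first.
  have /size1_polyC -> : (size y^`() <= 1)%N.
    by rewrite (leq_trans (size_poly _ _)) // -ltnS; case: (size y) sy.
  by rewrite !hornerC.
have E' := jacobi_eq_deriv E.
have l'0 : 0 < l - (a + b + 2) by lra.
have s1 : 0 < a + 1 + (b + 1) + 1 by lra.
have t1 : 0 <= friction (a + 1) (b + 1) x by rewrite /friction; lra.
have := energy_left_le E' s1 x1 t1.
have x12 : -1 <= x <= 1 by rewrite x1 /=; nra.
move=> /(le_trans (energy_ge _ _ x12)); by rewrite ler_pM2l.
Qed.

(** At -1 the equation reads (2b+2) y'(-1) = - l y(-1), and |y'| is largest at -1;
    so y moves by at most |y(-1)| / 2 over a distance (b+1/2) / l. *)
Lemma sqr_left_end_le a b l y : - (1 / 2) < a -> - (1 / 2) < b ->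
  jacobi_eq a b l y -> deriv_tame a b l y -> a + b + 2 <= l ->
  y.[-1] ^+ 2 <= 4 * y.[-1 + (b + 2^-1) / l] ^+ 2.
Proof.
move=> ha hb E nd l2; have d0 : 0 < b + 2^-1 by lra.
set delta := b + 2^-1 in d0 *; have l0 : 0 < l by lra.
have dl : 0 < delta / l by rewrite divr_gt0.
have ler1 : -1 <= -1 + delta / l by rewrite lerDl ltW.
have [c] := @MVT_segment _ (horner y) (horner y^`()) _ _ ler1
  (fun x _ => is_derive_poly y x)
  (continuous_subspaceT (@continuous_horner _ y)).
rewrite in_itv /= => /andP[c1 c2].
rewrite (_ : _ + delta / l - -1 = delta / l); last by ring.
have D : y^`().[-1] = - (l * y.[-1]) / (2 * b + 2).
  have := jacobi_eqP (-1) E.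
  rewrite /friction sqrrN expr1n subrr mul0r add0r => e.
  have b2 : 2 * b + 2 != 0 by rewrite gt_eqF //; lra.
  apply: (mulIf b2); rewrite divfK //; lra.
have c3 : (a + b + 3) * c <= b - a.
  apply: (@le_trans _ _ ((a + b + 3) * (-1 + delta / l))).
    by rewrite ler_wpM2l //; lra.
  have : delta / l <= delta / (a + b + 2).
    by rewrite ler_wpM2l ?(ltW d0) // lef_pV2 ?posrE //; lra.
  have : (a + b + 3) * (delta / (a + b + 2)) <= 2 * delta.
    rewrite mulrA ler_pdivrMr; last lra.
    by rewrite /delta; nra.
  rewrite /delta; nra.
have := deriv_sqr_le_left ha hb E nd c1 c3; rewrite D.
move: (y.[-1]) (y.[-1 + _]) (y^`().[c]) => Y0 Y1 Z Zb YE.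
have : (Z * (delta / l)) ^+ 2 <= (Y0 / 2) ^+ 2.
  rewrite exprMn (le_trans (ler_wpM2r (sqr_ge0 _) Zb)) // -exprMn.
  rewrite (_ : _ / _ * _ = - (Y0 * (delta / (2 * b + 2)))); last first.
    by field; apply/andP; split; rewrite gt_eqF //; lra.
  rewrite sqrrN [(Y0 * (delta / _)) ^+ 2]exprMn [(Y0 / 2) ^+ 2]exprMn.
  rewrite ler_wpM2l ?sqr_ge0 //.
  rewrite ler_sqr ?nnegrE ?invr_ge0 ?divr_ge0 ?(ltW d0) //; last lra.
  by rewrite ler_pdivrMr /delta; lra.
rewrite -YE; move=> H.
have := sqr_ge0 (Y1 - Y0 / 2); have := sqr_ge0 (Y1 + Y0 / 2).
rewrite -subr_ge0 in H.
have {H} : 0 <= (Y0 / 2 - (Y1 - Y0)) * (Y0 / 2 + (Y1 - Y0)) by nra.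
nra.
Qed.
(** To the right of xd = -1 + (b+1/2) / l the growth of the energy suffices; to the
    left of xd, pass through y(-1) and return to xd. *)
Lemma left_layer_bound a b l y x z : - (1 / 2) < a -> - (1 / 2) < b ->
  jacobi_eq a b l y -> deriv_tame a b l y -> a + b + 2 <= l ->
  -1 <= x -> x <= z -> z <= 1 -> (b + 2^-1) / l <= 1 + z ->
  l * y.[x] ^+ 2 <=
  4 * ((1 + z) * l / (b + 2^-1)) `^ (2 * b + 1) * (energy l y).[z].
Proof.
move=> ha hb E nd l2 x1 xz z1 dz; have l0 : 0 < l by lra.
have d0 : 0 < b + 2^-1 by lra.
have e0 : 0 <= 2 * b + 1 by lra.
have grow v : -1 < v -> (b + 2^-1) / l <= 1 + v -> v <= z ->
    (energy l y).[v] <=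
    ((1 + z) * l / (b + 2^-1)) `^ (2 * b + 1) * (energy l y).[z].
  move=> v1 vd vz; have v0 : 0 < 1 + v by lra.
  have z0 : 0 < 1 + z by lra.
  have C0 : 0 <= (1 + z) * l / (b + 2^-1).
    by rewrite divr_ge0 ?(ltW d0) // mulr_ge0 ?(ltW l0) ?(ltW z0).
  have := energy_growth ha hb E (ltW l0) v1 vz z1.
  rewrite -ler_pdivlMr ?powR_gt0 // => /le_trans; apply.
  rewrite ler_pdivrMr ?powR_gt0 // mulrC mulrAC -powRM ?(ltW v0) //.
  rewrite ler_wpM2r //.
    by apply: energy_ge0; [exact: ltW | apply/andP; split; lra].
  have vl : b + 2^-1 <= (1 + v) * l by rewrite -ler_pdivrMr.
  apply: ge0_ler_powR; rewrite ?nnegrE ?mulr_ge0 ?invr_ge0 //;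
    rewrite ?(ltW z0) ?(ltW v0) ?(ltW l0) ?(ltW d0) //.
  rewrite (_ : _ * _ = (1 + z) * ((1 + v) * l / (b + 2^-1))); last by ring.
  by rewrite ler_peMr ?(ltW z0) // ler_pdivlMr // mul1r.
have F0 : 0 <= ((1 + z) * l / (b + 2^-1)) `^ (2 * b + 1) * (energy l y).[z].
  rewrite mulr_ge0 ?powR_ge0 //.
  by apply: energy_ge0; [exact: ltW | apply/andP; split; lra].
set xd := -1 + (b + 2^-1) / l.
have dl : 0 < (b + 2^-1) / l by rewrite divr_gt0.
have xd1 : -1 < xd by rewrite /xd; lra.
have xdd : (b + 2^-1) / l <= 1 + xd by rewrite /xd; lra.
have xdz : xd <= z by rewrite /xd; lra.
rewrite -mulrA; have [xx|xx] := leP xd x.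
  have x0 : -1 < x by lra.
  have xdx : (b + 2^-1) / l <= 1 + x by lra.
  have x12 : -1 <= x <= 1 by apply/andP; split; lra.
  have := le_trans (energy_ge l y x12) (grow x x0 xdx xz); lra.
have xd2 : -1 <= xd <= 1 by apply/andP; split; lra.
have := le_trans (energy_ge l y xd2) (grow xd xd1 xdd xdz).
have tx : 0 <= friction a b x.
  rewrite /friction subr_ge0; apply: (@le_trans _ _ ((a + b + 1) * xd)).
    by rewrite ler_wpM2l ?(ltW xx) //; lra.
  have : (b + 2^-1) / l <= (b + 2^-1) / (a + b + 2).
    by rewrite ler_wpM2l ?(ltW d0) // lef_pV2 ?posrE //; lra.
  have : (a + b + 1) * ((b + 2^-1) / (a + b + 2)) <= b + 2^-1.
    by rewrite mulrA ler_pdivrMr; nra.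
  rewrite /xd; nra.
have s0 : 0 < a + b + 1 by lra.
have x12 : -1 <= x <= 1 by apply/andP; split; lra.
have := le_trans (energy_ge l y x12) (energy_left_le E s0 x1 tx).
have := sqr_left_end_le ha hb E nd l2; rewrite -/xd.
move: (y.[-1]) (y.[xd]) => Y0 Y1; nra.
Qed.

(** * The Bernstein-type inequality *)

(** Here l is large enough for the two layers not to overlap and for the friction
    to be nonpositive on the right one. *)
Lemma weighted_bound_large a b l y x : - (1 / 2) < a -> - (1 / 2) < b ->
  jacobi_eq a b l y -> deriv_tame a b l y -> a + b + 2 <= l -> layer a b <= l ->
  layer a b * (a + b + 1) <= (2 * a + 1) * l -> -1 <= x <= 1 ->
  jacobi_weight (a + 2^-1) (b + 2^-1) x * y.[x] ^+ 2 <=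
  (1 + 4 * (layer a b / (b + 2^-1)) `^ (2 * b + 1) * 2 `^ (a + 2^-1))
  * (4 * expR 2) * ((layer a b / l) `^ (a + 2^-1) * 2 `^ (b + 2^-1))
  * y.[1] ^+ 2.
Proof.
move=> ha hb E nd l2 Ml Ml2 /andP[x1 x2].
have l0 : 0 < l by lra.
have d0 : 0 < b + 2^-1 by lra.
have s0 : 0 < a + b + 1 by lra.
have M0 := layer_gt0 s0.
have a0 : 0 <= a + 2^-1 by lra.
have p0 : 0 < layer a b / l by rewrite divr_gt0.
have p1 : layer a b / l <= 1 by rewrite ler_pdivrMr // mul1r.
pose B := (layer a b / l) `^ (a + 2^-1) * 2 `^ (b + 2^-1).
pose A := 4 * (layer a b / (b + 2^-1)) `^ (2 * b + 1) * 2 `^ (a + 2^-1).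
have A0 : 0 <= A by rewrite !mulr_ge0 ?powR_ge0.
have B0 : 0 <= B by rewrite mulr_ge0 ?powR_ge0.
have e1 : 1 <= expR 2 :> R by have := expR_ge1Dx (2 : R); lra.
rewrite -/A -/B.
set xp := 1 - layer a b / l; set xm := -1 + layer a b / l.
have Wp t : xp <= t -> t <= 1 -> jacobi_weight (a + 2^-1) (b + 2^-1) t <= B.
  move=> tp t1; apply: jacobi_weight_le; rewrite ?(ltW d0) //;
    rewrite /xp in tp *; lra.
have Fp t : xp <= t -> t <= 1 -> (energy l y).[t] <= l * y.[1] ^+ 2.
  move=> tp t1; apply: (energy_right_le E s0 t1); rewrite /friction.
  have : layer a b / l * (a + b + 1) <= 2 * a + 1 by rewrite mulrAC ler_pdivrMr.
  rewrite /xp in tp; nra.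
(* In the right layer the energy is at most its value at 1, and W is small. *)
have [xr|xr] := leP xp x.
  have := Fp x xr x2; have x12 : -1 <= x <= 1 by rewrite x1.
  move=> /(le_trans (energy_ge l y x12)); rewrite ler_pM2l // => yy.
  apply: (le_trans (ler_pM (jacobi_weight_ge0 _ _ _) (sqr_ge0 _)
    (Wp x xr x2) yy)).
  rewrite ler_wpM2r ?sqr_ge0 // ler_peMl //; nra.
have mid u : xm <= u -> u <= xp ->
    (energy l y).[u] * jacobi_weight (a + 2^-1) (b + 2^-1) u <=
    4 * expR 2 * (l * y.[1] ^+ 2 * B).
  move=> um up; apply: (le_trans (energy_middle_le E s0 l0 Ml um up (lexx _))).
  have pp : xp <= 1 by rewrite /xp; lra.
  apply: ler_wpM2l; first by rewrite mulr_ge0 ?expR_ge0.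
  apply: ler_pM; rewrite ?jacobi_weight_ge0 ?Fp ?Wp //.
  by apply: energy_ge0; [exact: ltW | apply/andP; split; rewrite /xp; lra].
rewrite -(ler_pM2l l0).
(* In the middle the weighted energy is carried over from xp. *)
have [xl|xl] := leP xm x.
  have x12 : -1 <= x <= 1 by rewrite x1.
  have := mid x xl (ltW xr).
  have := ler_wpM2r (jacobi_weight_ge0 (a + 2^-1) (b + 2^-1) x)
    (energy_ge l y x12).
  move: (jacobi_weight _ _ x) (energy l y).[x] (y.[x]) => W F Y h1 h2.
  have y0 := sqr_ge0 y.[1]; have e0 := expR_ge0 (2 : R).
  have : 0 <= A * (4 * expR 2 * (l * y.[1] ^+ 2 * B)).
    have l0' := ltW l0; apply: mulr_ge0 => //.
    apply: mulr_ge0; first exact: mulr_ge0.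
    by apply: mulr_ge0 => //; exact: mulr_ge0.
  lra.
(* In the left layer y is compared with the energy at xm, and W with W xm. *)
have xmp : xm <= xp by rewrite /xm /xp; lra.
have xm1 : xm <= 1 by rewrite /xm; lra.
have dM : (b + 2^-1) / l <= 1 + xm.
  rewrite /xm addrA subrr add0r ler_wpM2r ?invr_ge0 ?(ltW l0) //.
  have := @friction_le a b (-1) s0; rewrite lexx /=.
  have -> : (-1 <= 1 :> R) by lra.
  move=> /(_ isT) /(le_trans (ler_norm _)); rewrite /friction /layer.
  have := friction_bound_gt0 s0; nra.
have := left_layer_bound ha hb E nd l2 x1 (ltW xl) xm1 dM.
have -> : (1 + xm) * l = layer a b.
  by rewrite /xm addrA subrr add0r divfK // gt_eqF.
have Wx : jacobi_weight (a + 2^-1) (b + 2^-1) x <=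
    2 `^ (a + 2^-1) * jacobi_weight (a + 2^-1) (b + 2^-1) xm.
  have x12 : -1 <= x <= 1 by rewrite x1.
  have xmx : 1 + x <= 1 + xm by lra.
  apply: (@le_trans _ _ (2 `^ (a + 2^-1) * (1 + xm) `^ (b + 2^-1))).
    by apply: jacobi_weight_le; rewrite ?(ltW d0) //; lra.
  rewrite ler_wpM2l ?powR_ge0 // ler_peMl ?powR_ge0 //.
  apply: (@le_trans _ _ (1 `^ (a + 2^-1))); first by rewrite powR1.
  by apply: ge0_ler_powR; rewrite ?nnegrE //; rewrite /xm; lra.
move=> lb; have := mid xm (lexx _) xmp.
have lb0 : 0 <= l * y.[x] ^+ 2 by rewrite mulr_ge0 ?sqr_ge0 // ltW.
have := ler_pM lb0 (jacobi_weight_ge0 _ _ _) lb Wx.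
rewrite /A.
have y0 := sqr_ge0 y.[1]; have e0 := expR_ge0 (2 : R).
have q0 : 0 <= 4 * expR 2 * (l * y.[1] ^+ 2 * B).
  have l0' := ltW l0; apply: mulr_ge0; first exact: mulr_ge0.
  by apply: mulr_ge0 => //; exact: mulr_ge0.
set P2 := 2 `^ (a + 2^-1); set PM := (_ / _) `^ (2 * b + 1).
move: (jacobi_weight _ _ x) (jacobi_weight _ _ xm) => W Wm.
move: (energy l y).[xm] (y.[x]) => F Y h1 h2.
have PP : 0 <= 4 * PM * P2 by rewrite !mulr_ge0 ?powR_ge0.
have := ler_wpM2l PP h2; lra.
Qed.


End Energy.

(** For l below a fixed threshold L a crude bound is enough: compare y directly with
    y(1), and use that L^(a+1/2) l^(-a-1/2) >= 1. *)
Lemma jacobi_eq_weighted_bound (R : realType) (a b : R) :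
  - (1 / 2) < a -> - (1 / 2) < b ->
  exists2 K : R, 0 <= K & forall l y, jacobi_eq a b l y -> deriv_tame a b l y ->
    a + b + 2 <= l -> forall x, -1 <= x <= 1 ->
    jacobi_weight (a + 2^-1) (b + 2^-1) x * y.[x] ^+ 2 <=
    K * (y.[1] ^+ 2 * l `^ (- (a + 2^-1))).
Proof.
move=> ha hb.
have s0 : 0 < a + b + 1 by lra.
have d0 : 0 < b + 2^-1 by lra.
have a0 : 0 <= a + 2^-1 by lra.
have M0 := layer_gt0 s0; set M := layer a b in M0.
pose L := M + M * (a + b + 1) / (2 * a + 1).
have aa : 0 < 2 * a + 1 by lra.
have L0 : 0 < L by rewrite addr_gt0 // divr_gt0 // mulr_gt0.
pose K1 := (1 + 4 * (M / (b + 2^-1)) `^ (2 * b + 1) * 2 `^ (a + 2^-1))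
  * (4 * expR 2) * (M `^ (a + 2^-1) * 2 `^ (b + 2^-1)).
pose K2 := 4 * ((1 + 1) * L / (b + 2^-1)) `^ (2 * b + 1)
  * (2 `^ (a + 2^-1) * 2 `^ (b + 2^-1)) * L `^ (a + 2^-1).
have K10 : 0 <= K1 by rewrite !mulr_ge0 ?addr_ge0 ?mulr_ge0 ?powR_ge0 ?expR_ge0.
have K20 : 0 <= K2 by rewrite !mulr_ge0 ?powR_ge0.
exists (K1 + K2) => [|l y E nd l2 x x12]; first exact: addr_ge0.
have l0 : 0 < l by lra.
set r := y.[1] ^+ 2 * _.
have r0 : 0 <= r by rewrite mulr_ge0 ?powR_ge0 ?sqr_ge0.
rewrite mulrDl; have [Ll|lL] := leP L l.
  have Ml : M <= l.
    by apply: le_trans Ll; rewrite lerDl divr_ge0 ?mulr_ge0 // ltW.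
  have Ml2 : M * (a + b + 1) <= (2 * a + 1) * l.
    rewrite [leRHS]mulrC -ler_pdivrMr //; apply: le_trans Ll.
    by rewrite lerDr ltW.
  apply: (@le_trans _ _ (K1 * r)); last by rewrite lerDl mulr_ge0.
  apply: (le_trans (weighted_bound_large ha hb E nd l2 Ml Ml2 x12)).
  rewrite -/M (powR_div_exp _ (ltW M0) l0) le_eqVlt; apply/orP; left; apply/eqP.
  by rewrite /K1 /r; ring.
apply: (@le_trans _ _ (K2 * r)); last by rewrite lerDr mulr_ge0.
have /andP[x1 x2] := x12.
have dl : (b + 2^-1) / l <= 1 + 1 by rewrite ler_pdivrMr //; lra.
have := left_layer_bound ha hb E nd l2 x1 x2 (lexx 1) dl.
rewrite energy1 [leRHS]mulrCA ler_pM2l // => yy.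
have W1 : jacobi_weight (a + 2^-1) (b + 2^-1) x <=
    2 `^ (a + 2^-1) * 2 `^ (b + 2^-1).
  by apply: jacobi_weight_le => //; lra.
apply: (le_trans (ler_pM (jacobi_weight_ge0 _ _ _) (sqr_ge0 _) W1 yy)).
have pL : ((1 + 1) * l / (b + 2^-1)) `^ (2 * b + 1) <=
    ((1 + 1) * L / (b + 2^-1)) `^ (2 * b + 1).
  apply: ge0_ler_powR; first lra.
  - by rewrite nnegrE divr_ge0 ?mulr_ge0 ?(ltW l0) ?(ltW d0).
  - by rewrite nnegrE divr_ge0 ?mulr_ge0 ?(ltW L0) ?(ltW d0).
  by rewrite ler_wpM2r ?invr_ge0 ?(ltW d0) // ler_wpM2l // ltW.
have lL1 : 1 <= L `^ (a + 2^-1) * l `^ (- (a + 2^-1)).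
  rewrite -powR_div_exp ?(ltW L0) //.
  apply: (@le_trans _ _ (1 `^ (a + 2^-1))); first by rewrite powR1.
  have : 1 <= L / l by rewrite ler_pdivlMr // mul1r ltW.
  by move=> h; apply: ge0_ler_powR; rewrite ?nnegrE //; lra.
set V := 2 `^ _ * 2 `^ _.
have V0 : 0 <= V by rewrite mulr_ge0 ?powR_ge0.
set Y := y.[1] ^+ 2; have Y0 : 0 <= Y by exact: sqr_ge0.
set p := _ `^ (2 * b + 1) in pL *; have p0 : 0 <= p by exact: powR_ge0.
rewrite /K2 /r -/V -/Y; set p' := _ `^ (2 * b + 1) in pL *.
move: lL1; set g := L `^ _ * _ => lL1.
have -> : 4 * p' * V * L `^ (a + 2^-1) * (Y * l `^ (- (a + 2^-1))) =
    (4 * p' * V * Y) * g by rewrite /g; ring.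
have -> : V * (4 * p * Y) = (4 * p * V * Y) * 1 by ring.
have f0 : (0 : R) <= 4 * p by rewrite mulr_ge0.
apply: ler_pM => //; first by apply: mulr_ge0 => //; apply: mulr_ge0.
by rewrite !ler_wpM2r // ler_wpM2l.
Qed.

(** Since l >= n^2 >= ((n+1)/2)^2, the factor l^(-a-1/2) is O((n+1)^(-2a-1)), which
    multiplies y(1)^2 = O((n+1)^(2a)).  Degree 0 has l = 0 and is done by hand. *)
Lemma jacobi_weighted_bound (R : realType) (a b : R) :
  - (1 / 2) < a -> - (1 / 2) < b ->
  exists2 K : R, 0 <= K &
    forall P, is_jacobi a b P -> forall n x, -1 <= x <= 1 ->
    jacobi_weight (a + 2^-1) (b + 2^-1) x * (P n).[x] ^+ 2 <= K * harmonic n.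
Proof.
move=> ha hb; have [K K0 HK] := jacobi_eq_weighted_bound ha hb.
have a1 : -1 < a by lra.
have b1 : -1 < b by lra.
have a0 : 0 <= a + 2^-1 by lra.
have b0 : 0 <= b + 2^-1 by lra.
have [k k0 Hk] := jacobi_at1_le a1.
pose V : R := 2 `^ (a + 2^-1) * 2 `^ (b + 2^-1).
have V0 : 0 <= V by rewrite mulr_ge0 ?powR_ge0.
have k20 : 0 <= K * k * 2 `^ (2 * a + 1) by rewrite !mulr_ge0 ?powR_ge0.
have k10 : 0 <= V * k by rewrite mulr_ge0.
exists (V * k + K * k * 2 `^ (2 * a + 1)) => [|P JP n x x12].
  exact: addr_ge0.
have sP : forall j, size (P j) = j.+1 by case: JP.
have n0 : 0 < n.+1%:R :> R by rewrite ltr0n.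
have y1 := Hk b P JP n.
case: n n0 y1 => [|n] n0 y1.
  have /size1_polyC -> : (size (P 0%N) <= 1)%N by rewrite sP.
  have y0 : (P 0%N)`_0 ^+ 2 <= k.
    move: y1; rewrite {1}(@size1_polyC _ (P 0%N)) ?sP // hornerC.
    by rewrite powR1 mulr1.
  rewrite hornerC /= invr1 mulr1.
  apply: (@le_trans _ _ (V * k)); last by rewrite lerDl.
  apply: ler_pM; rewrite ?jacobi_weight_ge0 ?sqr_ge0 //.
  have /andP[x1 x2] := x12.
  by apply: jacobi_weight_le => //; lra.
have E : jacobi_eq a b (jacobi_ev a b n.+1) (P n.+1) by exact: jacobi_ode.
have m1 : 1 <= n.+1%:R :> R by rewrite ler1n.
have l2 : a + b + 2 <= jacobi_ev a b n.+1.
  by rewrite /jacobi_ev; move: m1; move: n.+1%:R => m m1; nra.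
have nd : deriv_tame a b (jacobi_ev a b n.+1) (P n.+1).
  apply/orP; rewrite sP; case: n m1 {E y1 n0 l2} => [|n] m1; [by right|left].
  have : 2 <= n.+2%:R :> R by rewrite ler_nat.
  by rewrite /jacobi_ev; move: n.+2%:R => m m2; nra.
apply: (le_trans (HK _ _ E nd l2 x x12)).
apply: (@le_trans _ _ (K * k * 2 `^ (2 * a + 1) * harmonic n.+1)); last first.
  by rewrite ler_wpM2r ?harmonic_ge0 // lerDr.
rewrite -[leRHS]mulrA -[leRHS]mulrA ler_wpM2l //.
have lm : (n.+2%:R / 2) ^+ 2 <= jacobi_ev a b n.+1.
  rewrite /jacobi_ev -[n.+2%:R]natr1; move: m1; move: n.+1%:R => m m1; nra.
have lp : jacobi_ev a b n.+1 `^ (- (a + 2^-1)) <=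
    (n.+2%:R / 2) `^ (- (2 * a + 1)).
  have -> : - (2 * a + 1) = 2%:R * - (a + 2^-1) by field.
  rewrite powRrM powR_mulrn ?divr_ge0 ?(ltW n0) //.
  have m20 : 0 < (n.+2%:R / 2) ^+ 2 :> R by rewrite exprn_gt0 // divr_gt0.
  have l0 := lt_le_trans m20 lm.
  rewrite !powRN lef_pV2 ?posrE ?powR_gt0 //.
  apply: ge0_ler_powR; rewrite ?nnegrE ?sqr_ge0 //.
  by apply: le_trans lm; exact: sqr_ge0.
apply: (le_trans (ler_pM (sqr_ge0 _) (powR_ge0 _ _) y1 lp)).
rewrite powRM ?(ltW n0) // -powR_inv1 // -powRrM mulN1r opprK.
rewrite -!mulrA ler_wpM2l // le_eqVlt; apply/orP; left; apply/eqP.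
rewrite mulrA -powRD; last by rewrite (gt_eqF n0) implybT.
rewrite (_ : 2 * a - (2 * a + 1) = -1); last by ring.
by rewrite powR_inv1 ?(ltW n0) // mulrC.
Qed.

(** * The Gram matrix *)

Lemma gram_entry_le (R : realType) (a b : R) :
  - (1 / 2) < a -> - (1 / 2) < b ->
  exists2 K : R, 0 <= K & forall P, is_jacobi a b P -> forall N (i j : 'I_N),
    `|gram a b P N i j| <= K * (Num.sqrt (harmonic i) * Num.sqrt (harmonic j)).
Proof.
move=> ha hb; have [K K0 HK] := jacobi_weighted_bound ha hb.
pose mu := @lebesgue_measure R; pose D : set R := `]-1, 1[%classic.
have mD : measurable D by exact: measurable_itv.
pose om := @jacobi_weight R (a - 2^-1) (b - 2^-1).
have iom : mu.-integrable D (EFin \o om).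
  by apply: integrable_jacobi_weight; lra.
exists (K * Rintegral mu D om) => [|P JP N i j].
  by rewrite mulr_ge0 // Rintegral_ge0 // => x _; exact: jacobi_weight_ge0.
pose h i : R := Num.sqrt (harmonic i).
pose f x := ((P i).[x] * (P j).[x]) * jacobi_weight a b x ^+ 2.
have w2 x : jacobi_weight a b x ^+ 2 = jacobi_weight (2 * a) (2 * b) x.
  rewrite /jacobi_weight exprMn -!powR_mulrn ?powR_ge0 // -!powRrM.
  by rewrite ![_ * 2%:R]mulrC.
have fE : f = fun x => (P i * P j).[x] * jacobi_weight (2 * a) (2 * b) x.
  by apply/funext => x; rewrite /f w2 hornerM.
have fi : mu.-integrable D (EFin \o f).
  by rewrite fE; apply: integrable_poly_weight; lra.
have ab x : -1 < x < 1 ->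
    jacobi_weight a b x ^+ 2 = jacobi_weight (a + 2^-1) (b + 2^-1) x * om x.
  move=> /andP[x1 x2]; have x10 : 0 < 1 - x by lra.
  have x20 : 0 < 1 + x by lra.
  have aE : 2 * a = (a + 2^-1) + (a - 2^-1) by ring.
  have bE : 2 * b = (b + 2^-1) + (b - 2^-1) by ring.
  rewrite w2 /om /jacobi_weight aE bE.
  rewrite !powRD ?(gt_eqF x10) ?(gt_eqF x20) ?implybT //.
  by ring.
have fb x : D x -> `|f x| <= K * (h i * h j) * om x.
  rewrite /D /= in_itv /= => x12; have x12' : -1 <= x <= 1.
    by have /andP[x1 x2] := x12; rewrite !ltW.
  have om0 : 0 <= om x by exact: jacobi_weight_ge0.
  have bi := HK P JP i x x12'; have bj := HK P JP j x x12'.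
  rewrite /f ab // [X in `|X|]mulrA normrM (ger0_norm om0) ler_wpM2r //.
  have := jacobi_weight_ge0 (a + 2^-1) (b + 2^-1) x.
  move: (jacobi_weight _ _ x) bi bj => W bi bj W0.
  rewrite -ler_sqr ?nnegrE ?mulr_ge0 ?sqrtr_ge0 // real_normK ?num_real //.
  rewrite (_ : _ ^+ 2 = (W * (P i).[x] ^+ 2) * (W * (P j).[x] ^+ 2));
    last by ring.
  rewrite (_ : (K * _) ^+ 2 = (K * h i ^+ 2) * (K * h j ^+ 2)); last by ring.
  rewrite /h !sqr_sqrtr ?harmonic_ge0 //.
  by apply: ler_pM => //; rewrite mulr_ge0 ?sqr_ge0.
have -> : gram a b P N i j = Rintegral mu D f.
  rewrite mxE Rintegral_cc_oo //.
  by have /measurable_EFinP := measurable_int _ fi.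
have io2 : mu.-integrable D (EFin \o (fun x => K * (h i * h j) * om x)).
  exact: (@integrableZl _ _ _ mu D mD (K * (h i * h j)) _ iom).
have := @le_Rintegral _ _ _ mu D _ _ mD (integrable_norm fi) io2 fb.
rewrite RintegralZl // mulrAC; apply: le_trans.
exact: (@le_normr_Rintegral _ _ _ mu D f mD fi).
Qed.

Theorem theorem4p17 (R : realType) (a b : R)
    (ha : - (1 / 2%:R) < a) (hb : - (1 / 2%:R) < b) :
  exists2 C : R, 0 < C &
    forall P : nat -> {poly R}, is_jacobi a b P ->
    forall N : nat, (1 <= N)%N ->
      lambda_max (gram a b P N) <= C * (1 + ln N%:R).
Proof.
have [K K0 HK] := gram_entry_le ha hb.
exists (K + 1) => [|P JP [//|n] _]; first by rewrite ltr_wpDl.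
have [ev _] := lambda_maxP (gram_sym a b P n.+1).
have h0 (i : 'I_n.+1) : 0 < Num.sqrt (harmonic i) :> R.
  by rewrite sqrtr_gt0 harmonic_gt0.
apply: (le_trans (eigenvalue_le_weights h0 (HK P JP n.+1) ev)).
rewrite (eq_bigr (fun i : 'I_n.+1 => harmonic i)) => [|i _]; last first.
  by rewrite sqr_sqrtr // harmonic_ge0.
have S0 : 0 <= \sum_(i < n.+1) harmonic i :> R.
  by apply: sumr_ge0 => i _; exact: harmonic_ge0.
apply: (@le_trans _ _ ((K + 1) * \sum_(i < n.+1) harmonic i)).
  by rewrite ler_wpM2r // lerDl.
by rewrite ler_wpM2l ?addr_ge0 // harmonic_le_ln.
Qed.
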